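(* Work in $\mathrm{GB}$. If $\mathbb P$ is a tame notion of class forcing and $\mathcal S=\langle\mathbb P,\mathcal G,\mathcal F\rangle$ is a stratified class symmetric system, then $\mathcal S$ is tame.
   Context: Base theory. $\mathrm{GB}$ is two-sorted Gödel--Bernays set theory without choice (lowercase variables for sets, uppercase for classes): Extensionality, Regularity, Pairing, Union, Infinity, Powerset for sets; Extensionality for classes; every set is a class; Separation ($a\cap A$ is a set for every set $a$ and class $A$); Collection (for every set $a$ and class relation $R$ with $\forall x\in a\,\exists y\,\langle x,y\rangle\in R$ there is a set $b$ with $\forall x\in a\,\exists y\in b\,\langle x,y\rangle\in R$); and class existence axioms equivalent to comprehension for first-order formulas (no class quantifiers; class parameters and atomic formulas $x\in X$, $X=Y$ allowed). A sequence $\langle D_i\mid i\in I\rangle$ of classes always means one coded by the single class $\{\langle i,d\rangle\mid i\in I,\ d\in D_i\}$. Class forcing and class symmetric systems. A notion of class forcing is a preorder $\mathbb P=\langle P,\le\rangle$ with $P,\le$ classes and weakest element $\mathsf 1$. A class symmetric system is a triple $\mathcal S=\langle\mathbb P,\mathcal G,\mathcal F\rangle$ where $\mathbb P$ is a notion of class forcing; $\mathcal G$ is a group of automorphisms of $\mathbb P$ parametrized by sets, i.e. there is a class $C_{\mathcal G}\subseteq V\times P^2$ such that for each $a\in\operatorname{dom}C_{\mathcal G}$, $\pi_a=\{\langle p,q\rangle\mid\langle a,p,q\rangle\in C_{\mathcal G}\}$ is an automorphism of $\mathbb P$ and $\mathcal G=\{\pi_a\mid a\in\operatorname{dom}C_{\mathcal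 G}\}$ is a group; $\mathcal F$ is a normal filter of subgroups of $\mathcal G$ with a base parametrized by sets, i.e. there is a class $C_{\mathcal F}\subseteq V\times\operatorname{dom}C_{\mathcal G}$ such that for every $a\in\operatorname{dom}C_{\mathcal F}$, $H_a=\{\pi_d\mid\langle a,d\rangle\in C_{\mathcal F}\}$ is a subgroup of $\mathcal G$; some $H_b$ equals $\mathcal G$; for all $a,b$ in $\operatorname{dom}C_{\mathcal F}$ there is $c$ in it with $H_c\subseteq H_a\cap H_b$; and for all $a\in\operatorname{dom}C_{\mathcal F}$, $d\in\operatorname{dom}C_{\mathcal G}$ there is $c\in\operatorname{dom}C_{\mathcal F}$ with $H_c\subseteq\pi_dH_a\pi_d^{-1}$. $\mathcal F$ consists of all subgroups $H=\{\pi_b\mid b\in C\}$ of $\mathcal G$, $C$ a class, with $H_a\subseteq H$ for some $a\in\operatorname{dom}C_{\mathcal F}$. Names. A $\mathbb P$-name is a set or class of pairs $\langle\dot y,p\rangle$ with (recursively) $\dot y$ a set-size $\mathbb P$-name and $p\in P$; $V^{\mathbb P}$ is the class of set-size $\mathbb P$-names. For $\pi\in\mathcal G$, $\pi(\dot x)=\{\langle\pi(\dot y),\pi(p)\rangle\mid\langle\dot y,p\rangle\in\dot x\}$. $\dot x$ is symmetric if $\{\pi\in\mathcal G\mid\pi(\dot x)=\dot x\}\in\mathcal F$, and hereditarily symmetric (an $\mathcal S$-name) if it is symmetric and recursively every $\dot y\in\operatorname{dom}(\dot x)$ is hereditarily symmetric. $\mathrm{HS}$ is the class of all set-size $\mathcal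 S$-names. Stratification. A set $b\subseteq P$ is symmetric if $\{\pi\in\mathcal G\mid\pi[b]=b\}\in\mathcal F$. $\mathcal S$ is stratified if for every set $a\subseteq P$ there is a symmetric set $b\subseteq P$ with $a\subseteq b$. Forcing relations. A forcing relation for atomic formulas for $\mathcal S$ is a class relation $\Vdash_0$ such that for all $p\in P$, $\dot x,\dot y\in\mathrm{HS}$: (1) $p\Vdash_0\dot x\in\dot y$ iff $\{q\in P\mid\exists\langle\dot z,r\rangle\in\dot y\,(q\le r\wedge q\Vdash_0\dot x=\dot z)\}$ is dense below $p$; (2) $p\Vdash_0\dot x\subseteq\dot y$ iff for every $\langle\dot z,r\rangle\in\dot x$ and every $s\le p,r$ there is $q\le s$ with $q\Vdash_0\dot z\in\dot y$; (3) $p\Vdash_0\dot x=\dot y$ iff $p\Vdash_0\dot x\subseteq\dot y$ and $p\Vdash_0\dot y\subseteq\dot x$. $\mathcal S$ admits forcing relations if such a class exists (it is then unique). Then for first-order formulas (set variables assigned elements of $\mathrm{HS}$, class variables assigned class $\mathcal S$-names): $p\Vdash_{\mathcal S}\dot x\in\dot y$, $p\Vdash_{\mathcal S}\dot x=\dot y$ as for $\Vdash_0$; $p\Vdash_{\mathcal S}\dot x\in\dot X$ iff $\forall q\le p\,\exists r\le q\,\exists\langle\dot z,s\rangle\in\dot X\,(r\le s\wedge r\Vdash_0\dot x=\dot z)$; $p\Vdash_{\mathcal S}\dot X=\dot Y$ iff $p\Vdash_{\mathcal S}\forall x(x\in\dot X\leftrightarrow x\in\dot Y)$; $p\Vdash_{\mathcal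 S}\varphi\wedge\psi$ iff both are forced by $p$; $p\Vdash_{\mathcal S}\neg\varphi$ iff no $q\le p$ forces $\varphi$; $p\Vdash_{\mathcal S}\exists z\,\varphi$ iff $\forall q\le p\,\exists r\le q\,\exists\dot z\in\mathrm{HS}\ r\Vdash_{\mathcal S}\varphi(\dot z)$. ($\forall,\to,\leftrightarrow$ abbreviate via $\neg,\wedge,\exists$.) The forcing relations $\Vdash_{\mathbb P}$ of $\mathbb P$, and ''$\mathbb P$ admits forcing relations'', are defined identically with $\mathrm{HS}$ and $\mathcal S$-names replaced by $V^{\mathbb P}$ and $\mathbb P$-names. Pretameness and tameness of $\mathbb P$. $D\subseteq P$ is predense below $q$ if every $r\le q$ is compatible with some element of $D$. $\mathbb P$ is pretame if for every $p\in P$ and every sequence $\langle D_i\mid i\in I\rangle$ of dense subclasses of $\mathbb P$ with $I$ a set, there are $q\le p$ and a set $\langle d_i\mid i\in I\rangle$ with $d_i\subseteq D_i$ and $d_i$ predense below $q$ for all $i\in I$. (Pretameness of $\mathbb P$ is known to imply that $\mathbb P$ admits forcing relations.) $\mathbb P$ is tame if it is pretame and preserves the powerset axiom, i.e. $\mathsf 1\Vdash_{\mathbb P}$ Powerset. Pretameness and tameness of $\mathcal S$. $\mathcal S$ is pretame if it admits forcing relations and for every class $\mathcal S$-name $\dot\Gamma$: $\mathsf 1\Vdash_{\mathcal S}\forall x\exists y\,(y=x\cap\dot\Gamma)$, and $\mathsf 1\Vdash_{\mathcal S}\forall x\,[(\dot\Gamma\text{ is a relation}\wedge\forall u\in x\,\exists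 v\,\langle u,v\rangle\in\dot\Gamma)\to\exists y\,\forall u\in x\,\exists v\in y\,\langle u,v\rangle\in\dot\Gamma]$. $\mathcal S$ is tame if it is pretame and preserves the powerset axiom, i.e. $\mathsf 1\Vdash_{\mathcal S}$ Powerset. *)

(* Defs.v *)
From Stdlib Require Import PeanoNat.

Set Implicit Arguments.
Unset Strict Implicit.

Record structure := Structure {
  vset : Type;
  vcls : Type;
  mem : vset -> vset -> Prop;
  cmem : vset -> vcls -> Prop
}.

Declare Scope gb_scope.
Delimit Scope gb_scope with gb.
Notation "x ∈ a" := (mem x a) (at level 70, no associativity) : gb_scope.
Notation "x ∈∈ A" := (cmem x A) (at level 70, no associativity) : gb_scope.
Open Scope gb_scope.

(** * First-order formulas with set and class variables, no class quantifier *)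

(* Set variables and class variables are two separate families indexed by nat;
   variables are named, and [FEx n phi] binds the set variable [n]. *)
Inductive fml : Type :=
| FIn (i j : nat)
| FEq (i j : nat)
| FInC (i J : nat)
| FEqC (J L : nat)
| FAnd (phi psi : fml)
| FNot (phi : fml)
| FEx (n : nat) (phi : fml).

Definition FOr phi psi := FNot (FAnd (FNot phi) (FNot psi)).
Definition FImp phi psi := FNot (FAnd phi (FNot psi)).
Definition FIff phi psi := FAnd (FImp phi psi) (FImp psi phi).
Definition FAll n phi := FNot (FEx n (FNot phi)).

Definition upd {T : Type} (s : nat -> T) (n : nat) (x : T) : nat -> T :=
  fun k => if Nat.eqb k n then x else s k.

Fixpoint sat (M : structure) (phi : fml)
    (s : nat -> vset M) (t : nat -> vcls M) : Prop :=
  match phi with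
  | FIn i j => s i ∈ s j
  | FEq i j => s i = s j
  | FInC i J => s i ∈∈ t J
  | FEqC J L => t J = t L
  | FAnd phi psi => sat phi s t /\ sat psi s t
  | FNot phi => ~ sat phi s t
  | FEx n phi => exists x, sat phi (upd s n x) t
  end.

(* c = {a,b}, with [w] a variable distinct from [c], [a], [b]. *)
Definition FUPair (c a b w : nat) : fml :=
  FAll w (FIff (FIn w c) (FOr (FEq w a) (FEq w b))).

(* z = <x,y> = {{x},{x,y}}.  Variables 10-13 are kept for the bound variables
   of the next two formulas; their arguments must be < 10 (10 is also allowed
   for [z] in [FPair]). *)
Definition FPair (z x y : nat) : fml :=
  FEx 11 (FEx 12 (FAnd (FUPair 11 x x 13)
                 (FAnd (FUPair 12 x y 13) (FUPair z 11 12 13)))).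

Definition FPairInC (x y G : nat) : fml :=
  FEx 10 (FAnd (FPair 10 x y) (FInC 10 G)).

Definition powerset_fml : fml :=
  FAll 0 (FEx 1 (FAll 2 (FIff (FIn 2 1)
                              (FAll 3 (FImp (FIn 3 2) (FIn 3 0)))))).

(* forall x, exists y, y = x ∩ Γ; Γ is class variable 0. *)
Definition separation_fml : fml :=
  FAll 0 (FEx 1 (FAll 2 (FIff (FIn 2 1) (FAnd (FIn 2 0) (FInC 2 0))))).

Definition relation_fml (G : nat) : fml :=
  FAll 2 (FImp (FInC 2 G) (FEx 3 (FEx 4 (FPair 2 3 4)))).

(* forall x, (Γ is a relation /\ forall u in x, exists v, <u,v> ∈ Γ) ->
     exists y, forall u in x, exists v in y, <u,v> ∈ Γ,
   with x, u, v, y the variables 0, 1, 2, 3 and Γ class variable 0. *)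
Definition collection_fml : fml :=
  FAll 0 (FImp
    (FAnd (relation_fml 0)
          (FAll 1 (FImp (FIn 1 0) (FEx 2 (FPairInC 1 2 0)))))
    (FEx 3 (FAll 1 (FImp (FIn 1 0)
                         (FEx 2 (FAnd (FIn 2 3) (FPairInC 1 2 0))))))).

Section GBTheory.
Context {M : structure}.
Implicit Types (a b c d p q r s t u v w x y z : vset M).
Implicit Types (A B C X Y Z : vcls M).
Implicit Types (K : vset M -> Prop).

(** * Coding of pairs *)

(* Operations on sets are relational: "z is the pair <x,y>".  Sets and classes
   are both handled as predicates [vset M -> Prop] through [elts], [celts]. *)
Definition elts a : vset M -> Prop := fun x => x ∈ a.
Definition celts A : vset M -> Prop := fun x => x ∈∈ A.

Definition is_upair c a b := forall x, x ∈ c <-> x = a \/ x = b.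

Definition is_pair z x y :=
  exists c d, is_upair c x x /\ is_upair d x y /\ is_upair z c d.

(* <a,p,q> is <a,<p,q>>. *)
Definition is_triple z a p q := exists y, is_pair y p q /\ is_pair z a y.

Definition pair_in x y K := exists z, is_pair z x y /\ K z.
Definition triple_in a p q K := exists z, is_triple z a p q /\ K z.

Definition dom K x := exists y, pair_in x y K.

(* Z = {<p,q> | R p q} *)
Definition is_graph Z (R : vset M -> vset M -> Prop) :=
  forall z, z ∈∈ Z <-> exists p q, is_pair z p q /\ R p q.

(** * The theory GB *)

Record GB : Prop := {
  gb_ext : forall a b, (forall x, x ∈ a <-> x ∈ b) -> a = b;
  gb_regularity : forall a, (exists x, x ∈ a) ->
    exists x, x ∈ a /\ forall y, y ∈ a -> ~ y ∈ x;
  gb_pairing : forall a b, exists c, is_upair c a b;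
  gb_union : forall a, exists b, forall x, x ∈ b <-> exists y, y ∈ a /\ x ∈ y;
  gb_infinity : exists a,
    (exists e, e ∈ a /\ forall x, ~ x ∈ e) /\
    (forall x, x ∈ a ->
       exists y, y ∈ a /\ forall z, z ∈ y <-> z ∈ x \/ z = x);
  gb_powerset : forall a, exists b, forall x,
    x ∈ b <-> (forall y, y ∈ x -> y ∈ a);
  gb_cls_ext : forall A B, (forall x, x ∈∈ A <-> x ∈∈ B) -> A = B;
  gb_set_cls : forall a, exists A, forall x, x ∈∈ A <-> x ∈ a;
  gb_separation : forall a A, exists b, forall x, x ∈ b <-> x ∈ a /\ x ∈∈ A;
  gb_collection : forall a (R : vcls M),
    (forall x, x ∈ a -> exists y, pair_in x y (celts R)) ->
    exists b, forall x, x ∈ a -> exists y, y ∈ b /\ pair_in x y (celts R);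
  gb_comprehension : forall (phi : fml) (s : nat -> vset M) (t : nat -> vcls M)
      (n : nat), exists A, forall x, x ∈∈ A <-> sat phi (upd s n x) t
}.

(** * Notions of class forcing *)

Record forcing_triple := ForcingTriple {
  cond : vcls M;
  leq : vcls M;
  one : vset M
}.
Implicit Types (PP : forcing_triple).

Definition le PP p q := pair_in p q (celts (leq PP)).

Record class_forcing PP : Prop := {
  cf_leq : forall z, z ∈∈ leq PP ->
    exists p q, is_pair z p q /\ p ∈∈ cond PP /\ q ∈∈ cond PP;
  cf_refl : forall p, p ∈∈ cond PP -> le PP p p;
  cf_trans : forall p q r, le PP p q -> le PP q r -> le PP p r;
  cf_one : one PP ∈∈ cond PP;
  cf_weakest : forall p, p ∈∈ cond PP -> le PP p (one PP)
}.

Definition dense_below PP K p := forall s, le PP s p -> exists q, le PP q s /\ K q.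

Definition dense PP K := forall p, p ∈∈ cond PP -> exists q, le PP q p /\ K q.

Definition compatible PP p q := exists s, le PP s p /\ le PP s q.

Definition predense_below PP K q :=
  forall r, le PP r q -> exists d, K d /\ compatible PP r d.

(* The collection K of pairs <i,d> codes a sequence indexed by the set I, and
   [section K i] is its i-th term. *)
Definition codes_sequence K (I : vset M) :=
  forall z, K z -> exists i d, i ∈ I /\ is_pair z i d.
Definition section K i : vset M -> Prop := fun d => pair_in i d K.

Definition pretame PP :=
  forall p (I : vset M) (D : vcls M), p ∈∈ cond PP ->
    codes_sequence (celts D) I ->
    (forall i, i ∈ I ->
       (forall d, section (celts D) i d -> d ∈∈ cond PP) /\
       dense PP (section (celts D) i)) ->
    exists q e, le PP q p /\ codes_sequence (elts e) I /\
      forall i, i ∈ I ->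
        (forall d, section (elts e) i d -> section (celts D) i d) /\
        predense_below PP (section (elts e) i) q.

(** * Names *)

(* Every element of K is a pair <y,p> with y in N and p a condition. *)
Definition name_over PP (N : vset M -> Prop) K :=
  forall u, K u -> exists y p, is_pair u y p /\ N y /\ p ∈∈ cond PP.

(* The predicate H defined by ∈-recursion through
     H x  <->  Q x and every u in x is <y,p> with H y and p a condition,
   written with a set [t] of approximations. *)
Definition hereditarily PP (Q : vset M -> Prop) x :=
  exists t, x ∈ t /\ forall y, y ∈ t -> Q y /\ name_over PP (elts t) (elts y).

Definition set_name PP x := hereditarily PP (fun _ => True) x.

Definition class_name PP A := name_over PP (set_name PP) (celts A).

(* L = {<z',p'> | <z,p> ∈ K, z' = R(z), p' = X(p)} *)
Definition moves X (R : vset M -> vset M -> Prop) K (L : vset M -> Prop) :=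
  forall w, L w <-> exists z p z' p', pair_in z p K /\ R z z' /\
                      pair_in p p' (celts X) /\ is_pair w z' p'.

(* y = X(x) for an automorphism X and a set name x: the recursion on names is
   carried out along a set [f] of pairs <u,X(u)>. *)
Definition act X x y :=
  exists f, pair_in x y (elts f) /\
    forall u v, pair_in u v (elts f) ->
      moves X (fun z z' => pair_in z z' (elts f)) (elts u) (elts v) /\
      forall z p, pair_in z p (elts u) -> exists z', pair_in z z' (elts f).

Definition cact X A B := moves X (act X) (celts A) (celts B).

(** * Class symmetric systems *)

Definition automorphism PP X :=
  (forall z, z ∈∈ X ->
     exists p q, is_pair z p q /\ p ∈∈ cond PP /\ q ∈∈ cond PP) /\
  (forall p, p ∈∈ cond PP -> exists! q, pair_in p q (celts X)) /\
  (forall q, q ∈∈ cond PP -> exists! p, pair_in p q (celts X)) /\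
  (forall p q p' q', pair_in p p' (celts X) -> pair_in q q' (celts X) ->
     (le PP p q <-> le PP p' q')).

Definition is_id PP X := is_graph X (fun p q => p ∈∈ cond PP /\ q = p).
Definition is_inv Y X := is_graph Y (fun p q => pair_in q p (celts X)).
(* Z is X after Y. *)
Definition is_comp Z X Y :=
  is_graph Z (fun p r => exists q, pair_in p q (celts Y) /\ pair_in q r (celts X)).

(* Collections of automorphisms, which are classes, are predicates on [vcls M]. *)
Definition group_of_classes PP (H : vcls M -> Prop) :=
  (forall X, is_id PP X -> H X) /\
  (forall X Y Z, H X -> H Y -> is_comp Z X Y -> H Z) /\
  (forall X Y, H X -> is_inv Y X -> H Y).

(* The system <PP,G,F>, with G and F given by the coding classes C_G, C_F. *)
Record system := System {
  forc : forcing_triple;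
  cG : vcls M;
  cF : vcls M
}.
Implicit Types (S : system).

Definition is_pi S a X := is_graph X (fun p q => triple_in a p q (celts (cG S))).
Definition domG S a := dom (celts (cG S)) a.
Definition domF S a := dom (celts (cF S)) a.

Definition grp S X := exists a, domG S a /\ is_pi S a X.

Definition subgroup S (H : vcls M -> Prop) :=
  (forall X, H X -> grp S X) /\ group_of_classes (forc S) H.

(* H_a = {π_d | <a,d> ∈ C_F} *)
Definition base S a X := exists d, pair_in a d (celts (cF S)) /\ is_pi S d X.

(* X = D Y D^-1 *)
Definition is_conj X D Y :=
  exists D' W, is_inv D' D /\ is_comp W Y D' /\ is_comp X D W.

Record class_symmetric_system S : Prop := {
  ss_forcing : class_forcing (forc S);
  ss_cG : forall z, z ∈∈ cG S -> exists a p q,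
    is_triple z a p q /\ p ∈∈ cond (forc S) /\ q ∈∈ cond (forc S);
  ss_aut : forall a X, domG S a -> is_pi S a X -> automorphism (forc S) X;
  ss_group : group_of_classes (forc S) (grp S);
  ss_cF : forall z, z ∈∈ cF S -> exists a d, is_pair z a d /\ domG S d;
  ss_base : forall a, domF S a -> subgroup S (base S a);
  ss_top : exists b, domF S b /\ forall X, base S b X <-> grp S X;
  ss_inter : forall a b, domF S a -> domF S b ->
    exists c, domF S c /\ forall X, base S c X -> base S a X /\ base S b X;
  ss_normal : forall a d, domF S a -> domG S d ->
    exists c, domF S c /\ forall X, base S c X ->
      exists D Y, is_pi S d D /\ base S a Y /\ is_conj X D Y
}.

(* H ∈ F *)
Definition in_filter S (H : vcls M -> Prop) :=
  subgroup S H /\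
  (exists C, (forall b, b ∈∈ C -> domG S b) /\
             forall X, H X <-> exists b, b ∈∈ C /\ is_pi S b X) /\
  (exists a, domF S a /\ forall X, base S a X -> H X).

Definition symmetric S x := in_filter S (fun X => grp S X /\ act X x x).
Definition csymmetric S A := in_filter S (fun X => grp S X /\ cact X A A).

Definition HS S x := hereditarily (forc S) (symmetric S) x.

Definition class_S_name S A :=
  csymmetric S A /\ name_over (forc S) (HS S) (celts A).

Definition symmetric_set S b :=
  in_filter S (fun X => grp S X /\
    forall q, q ∈ b <-> exists p, p ∈ b /\ pair_in p q (celts X)).

Definition stratified S :=
  forall a, (forall p, p ∈ a -> p ∈∈ cond (forc S)) ->
    exists b, (forall p, p ∈ b -> p ∈∈ cond (forc S)) /\
      symmetric_set S b /\ (forall p, p ∈ a -> p ∈ b).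

(** * Forcing relations *)

(* A class relation ⊩0, split into the three relations p ⊩0 x ∈ y,
   p ⊩0 x ⊆ y and p ⊩0 x = y. *)
Record atomic := Atomic { aIn : vcls M; aSub : vcls M; aEq : vcls M }.
Implicit Types (F : atomic).

Definition fIn F p x y := triple_in p x y (celts (aIn F)).
Definition fSub F p x y := triple_in p x y (celts (aSub F)).
Definition fEq F p x y := triple_in p x y (celts (aEq F)).

(* [N] is the range of the set names: [set_name PP] or [HS S]. *)
Definition atomic_forcing PP (N : vset M -> Prop) F :=
  forall p x y, p ∈∈ cond PP -> N x -> N y ->
    (fIn F p x y <->
       dense_below PP (fun q => q ∈∈ cond PP /\ exists z r,
         pair_in z r (elts y) /\ le PP q r /\ fEq F q x z) p) /\
    (fSub F p x y <->
       forall z r, pair_in z r (elts x) ->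
         forall s, le PP s p -> le PP s r ->
           exists q, le PP q s /\ fIn F q z y) /\
    (fEq F p x y <-> fSub F p x y /\ fSub F p y x).

Definition admits_forcing PP N := exists F, atomic_forcing PP N F.

Section Forces.
Variables (PP : forcing_triple) (N : vset M -> Prop) (F : atomic).

Definition fInC p x A :=
  forall q, le PP q p -> exists r, le PP r q /\
    exists z t, pair_in z t (celts A) /\ le PP r t /\ fEq F r x z.

Definition fNot (K : vset M -> Prop) p := forall q, le PP q p -> ~ K q.
Definition fAnd (K L : vset M -> Prop) p := K p /\ L p.
Definition fEx (K : vset M -> vset M -> Prop) p :=
  forall q, le PP q p -> exists r, le PP r q /\ exists z, N z /\ K z r.
Definition fImp (K L : vset M -> Prop) := fNot (fAnd K (fNot L)).
Definition fIff (K L : vset M -> Prop) := fAnd (fImp K L) (fImp L K).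
Definition fAll (K : vset M -> vset M -> Prop) := fNot (fEx (fun z => fNot (K z))).

Fixpoint forces (phi : fml) (s : nat -> vset M) (t : nat -> vcls M)
    : vset M -> Prop :=
  match phi with
  | FIn i j => fun p => fIn F p (s i) (s j)
  | FEq i j => fun p => fEq F p (s i) (s j)
  | FInC i J => fun p => fInC p (s i) (t J)
  | FEqC J L =>
      fAll (fun x => fIff (fun p => fInC p x (t J)) (fun p => fInC p x (t L)))
  | FAnd phi psi => fAnd (forces phi s t) (forces psi s t)
  | FNot phi => fNot (forces phi s t)
  | FEx n phi => fEx (fun z => forces phi (upd s n z) t)
  end.
End Forces.

(* 1 ⊩ phi, for phi without free set variables and with at most the class
   variable 0 free, interpreted by A: the forcing relation ⊩0, which is unique on names, exists
   and the induced relation holds of 1.  The set assignment is a dummy. *)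
Definition one_forces PP (N : vset M -> Prop) (phi : fml) A :=
  exists F, atomic_forcing PP N F /\
    forces PP N F phi (fun _ => one PP) (fun _ => A) (one PP).

(** * Tameness *)

(* [powerset_fml] has no class variable; [cond PP] is a dummy. *)
Definition forces_powerset PP (N : vset M -> Prop) :=
  one_forces PP N powerset_fml (cond PP).

Definition tame PP := pretame PP /\ forces_powerset PP (set_name PP).

Definition system_pretame S :=
  admits_forcing (forc S) (HS S) /\
  forall A, class_S_name S A ->
    one_forces (forc S) (HS S) separation_fml A /\
    one_forces (forc S) (HS S) collection_fml A.

Definition system_tame S :=
  system_pretame S /\ forces_powerset (forc S) (HS S).

End GBTheory.

Arguments GB : clear implicits.
Arguments forcing_triple : clear implicits.
Arguments system : clear implicits.
Arguments atomic : clear implicits.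

(* Main.v *)
From Stdlib Require Import PeanoNat Lia Classical ClassicalEpsilon FunctionalExtensionality.
Require Import Defs.

(** For each axiom, pretameness of the forcing PP reduces the required name to set
    many conditions, and stratification encloses these in a symmetric set, which
    makes the name symmetric.

    The forcing relation for atomic formulas of PP restricts to symmetric names
    ([atomic_forcing_HS]), because its clauses never leave the names inside those
    compared.  It is invariant under automorphisms ([act_fEq] and its
    consequences), and more generally the truth values of formulas are definable
    ([Cls3_forces]), regular ([forces_regular]) and compatible with forced
    equality ([forces_congr]).

    Pretameness of PP bounds by a set the conditions that matter for an instance
    of Separation, Collection or Powerset ([pretame_decide]).  Stratification
    encloses this set of conditions in a symmetric set b.  It also does so for
    sets of symmetric names ([symmetric_cover]): if b contains all conditions
    occurring in a set B of names, then the action of an automorphism preserving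
    b on names from B depends only on its restriction to b.  This restriction is
    a subset of b × b, so there are only set many actions and the orbit of B
    under a group from the filter is a set ([orbit_set]).  In the absence of
    choice, witnesses are always collected, never chosen.

    - Separation: the pairs ⟨z,s⟩ with z inside x, s in b and s forcing
      z ∈ x ∩ Γ form a name for x ∩ Γ.
    - Collection: symmetric witnesses for the conditions provided by pretameness
      are collected and enclosed in a symmetric set B'; the name is B' × b.
    - Powerset: by tameness there is a PP-name yP for the powerset of x.  Every
      symmetric name for a subset of x is densely equal to an element of yP, and
      pretameness makes set many symmetric names suffice to represent those
      elements of yP that are equal to symmetric names.  The name consists of
      the pairs ⟨v,s⟩ where v is in a symmetric cover of these names and s in b
      forces v ⊆ x.

    All recursions on names are carried out inside the model, which need not be
    well-founded.  Induction on names rests on the regularity axiom for sets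
    ([regularity_dom]), and class comprehension on a calculus of definable
    relations whose closure properties are applied by the tactic [define]. *)

Set Implicit Arguments.
Unset Strict Implicit.

Existing Class GB.

(** * Pairs and definable relations *)

Section Definability.
Context {M : structure} {hGB : GB M}.
Implicit Types (P Q : (nat -> vset M) -> Prop) (s : nat -> vset M).
Implicit Types (f g : (nat -> vset M) -> vset M).

Lemma upd_eq {T : Type} (s : nat -> T) n x : upd s n x n = x.
Proof. unfold upd; now rewrite Nat.eqb_refl. Qed.

Lemma upd_neq {T : Type} (s : nat -> T) n x i : i <> n -> upd s n x i = s i.
Proof. intros h; unfold upd; now apply Nat.eqb_neq in h as ->. Qed.

Lemma set_ext (a b : vset M) : (forall x, x ∈ a <-> x ∈ b) -> a = b.
Proof. exact (gb_ext hGB (a:=a) (b:=b)). Qed.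

Lemma is_upair_unique c d (a b : vset M) :
  is_upair c a b -> is_upair d a b -> c = d.
Proof. intros hc hd; apply set_ext; intros x; now rewrite (hc x), (hd x). Qed.

Lemma is_upair_inj c (a b a' b' : vset M) : is_upair c a b -> is_upair c a' b' ->
  (a = a' /\ b = b') \/ (a = b' /\ b = a').
Proof.
intros h h'.
assert (H : forall x, x = a \/ x = b <-> x = a' \/ x = b')
  by (intros x; now rewrite <- (h x), <- (h' x)).
destruct (proj1 (H a)), (proj1 (H b)), (proj2 (H a')), (proj2 (H b'));
  auto; subst; auto.
Qed.

Lemma is_pair_unique z z' (x y : vset M) : is_pair z x y -> is_pair z' x y -> z = z'.
Proof.
intros (c & d & hc & hd & hz) (c' & d' & hc' & hd' & hz').
rewrite (is_upair_unique hc' hc), (is_upair_unique hd' hd) in *.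
exact (is_upair_unique hz hz').
Qed.

Lemma is_pair_inj z (x y x' y' : vset M) :
  is_pair z x y -> is_pair z x' y' -> x = x' /\ y = y'.
Proof.
intros (c & d & hc & hd & hz) (c' & d' & hc' & hd' & hz').
destruct (is_upair_inj hz hz') as [[<- <-]|[<- <-]].
- destruct (is_upair_inj hc hc') as [[<- _]|[<- _]];
  destruct (is_upair_inj hd hd') as [[e1 e2]|[e1 e2]]; subst; auto.
- destruct (is_upair_inj hc hd') as [[e1 e2]|[e1 e2]];
  destruct (is_upair_inj hd hc') as [[e3 e4]|[e3 e4]]; subst; auto.
Qed.

Lemma is_pair_exists (x y : vset M) : exists z, is_pair z x y.
Proof.
destruct (gb_pairing hGB x x) as [c hc], (gb_pairing hGB x y) as [d hd],
  (gb_pairing hGB c d) as [z hz].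
exists z, c, d; auto.
Qed.

Definition pr (x y : vset M) : vset M :=
  proj1_sig (constructive_indefinite_description _ (is_pair_exists x y)).

Lemma pr_spec x y : is_pair (pr x y) x y.
Proof. unfold pr; now destruct constructive_indefinite_description. Qed.

Lemma is_pairE z x y : is_pair z x y <-> z = pr x y.
Proof.
split; [intros h; exact (is_pair_unique h (pr_spec x y))|intros ->; apply pr_spec].
Qed.

Lemma pr_inj x y x' y' : pr x y = pr x' y' -> x = x' /\ y = y'.
Proof.
intros e; apply (is_pair_inj (pr_spec x y)); rewrite e; apply pr_spec.
Qed.

Lemma pair_inE x y K : pair_in x y K <-> K (pr x y).
Proof.
split.
- intros (z & hz & hK); now apply is_pairE in hz as ->.
- intros hK; exists (pr x y); split; [apply pr_spec|exact hK].
Qed.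

Lemma triple_inE x y z K : triple_in x y z K <-> K (pr x (pr y z)).
Proof.
split.
- intros (w & (v & hv & hw) & hK).
  now apply is_pairE in hv as ->; apply is_pairE in hw as ->.
- intros hK; exists (pr x (pr y z)); split; [|exact hK].
  exists (pr y z); split; apply pr_spec.
Qed.

Fixpoint rename_classes (r : nat -> nat) (phi : fml) : fml :=
  match phi with
  | FIn i j => FIn i j
  | FEq i j => FEq i j
  | FInC i J => FInC i (r J)
  | FEqC J L => FEqC (r J) (r L)
  | FAnd phi psi => FAnd (rename_classes r phi) (rename_classes r psi)
  | FNot phi => FNot (rename_classes r phi)
  | FEx n phi => FEx n (rename_classes r phi)
  end.

Lemma sat_rename_classes r phi s (t : nat -> vcls M) :
  sat (rename_classes r phi) s t <-> sat phi s (fun k => t (r k)).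
Proof.
revert s; induction phi; intros s; cbn; try tauto.
- now rewrite IHphi1, IHphi2.
- now rewrite IHphi.
- split; intros [x hx]; exists x; now apply IHphi.
Qed.

(** Comprehension speaks of the deep embedding [fml]; here the formula is hidden
    behind its meaning [P], so that closure properties can be applied to shallow
    statements.  The number [k] records that the variables in use are those
    below [k], which lets [define] take [k] as the next bound variable. *)
Definition definable (k : nat) P :=
  exists phi (t : nat -> vcls M), forall s, sat phi s t <-> P s.

Lemma definable_iff k P Q :
  (forall s, P s <-> Q s) -> definable k P -> definable k Q.
Proof.
intros h (phi & t & H); exists phi, t; intros s; rewrite H; apply h.
Qed.

Lemma definable_level k k' P : definable k P -> definable k' P.
Proof. exact (fun h => h). Qed.

Lemma some_class : exists A : vcls M, True.
Proof.
destruct (gb_infinity hGB) as [a _], (gb_set_cls hGB a) as [A _]; now exists A.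
Qed.

Lemma definable_const k (p : Prop) : definable k (fun _ => p).
Proof.
destruct some_class as [A _], (classic p).
- exists (FEqC 0 0), (fun _ => A); cbn; tauto.
- exists (FNot (FEqC 0 0)), (fun _ => A); cbn; tauto.
Qed.

Lemma definable_not k P : definable k P -> definable k (fun s => ~ P s).
Proof.
intros (phi & t & H); exists (FNot phi), t; intros s; cbn; now rewrite H.
Qed.

Lemma definable_and k P Q :
  definable k P -> definable k Q -> definable k (fun s => P s /\ Q s).
Proof.
intros (phi & t & H) (psi & u & H').
(* The two families of class parameters are interleaved into one. *)
set (v := fun i => if Nat.even i then t (Nat.div2 i) else u (Nat.div2 i)).
assert (E : forall i, Nat.even (2 * i) = true)
  by (intros i; apply Nat.even_spec; now exists i).
assert (ht : (fun i => v (2 * i)) = t)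
  by (extensionality i; unfold v; now rewrite E, Nat.div2_double).
assert (hu : (fun i => v (S (2 * i))) = u).
{ extensionality i; unfold v.
  now rewrite Nat.even_succ, <- Nat.negb_even, E, Nat.div2_succ_double. }
exists (FAnd (rename_classes (fun i => 2 * i) phi)
             (rename_classes (fun i => S (2 * i)) psi)), v.
intros s; cbn [sat]; rewrite !sat_rename_classes, ht, hu, H, H'; reflexivity.
Qed.

Lemma definable_or k P Q :
  definable k P -> definable k Q -> definable k (fun s => P s \/ Q s).
Proof.
intros hP hQ; apply definable_iff with (P := fun s => ~ (~ P s /\ ~ Q s)).
- intros s; tauto.
- auto using definable_not, definable_and.
Qed.

Lemma definable_imp k P Q :
  definable k P -> definable k Q -> definable k (fun s => P s -> Q s).
Proof.
intros hP hQ; apply definable_iff with (P := fun s => ~ (P s /\ ~ Q s)).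
- intros s; tauto.
- auto using definable_not, definable_and.
Qed.

Lemma definable_equiv k P Q :
  definable k P -> definable k Q -> definable k (fun s => P s <-> Q s).
Proof. intros; apply definable_and; now apply definable_imp. Qed.

Lemma definable_upd k n P :
  definable k P -> definable k (fun s => exists x, P (upd s n x)).
Proof.
intros (phi & t & H); exists (FEx n phi), t; intros s; cbn.
split; intros [x hx]; exists x; now apply H.
Qed.

Lemma definable_ex k (P : (nat -> vset M) -> vset M -> Prop) :
  (forall s x y, P (upd s k x) y = P s y) ->
  definable (S k) (fun s => P s (s k)) ->
  definable k (fun s => exists x, P s x).
Proof.
intros h hP; generalize (definable_upd k hP); apply definable_iff.
intros s; split; intros [x hx]; exists x; rewrite h, upd_eq in *; exact hx.
Qed.

Lemma definable_all k (P : (nat -> vset M) -> vset M -> Prop) :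
  (forall s x y, P (upd s k x) y = P s y) ->
  definable (S k) (fun s => P s (s k)) ->
  definable k (fun s => forall x, P s x).
Proof.
intros h hP; apply definable_iff with (P := fun s => ~ exists x, ~ P s x).
- intros s; split; [|intros h' [x hx]; auto].
  intros hn x; apply NNPP; intros hx; apply hn; now exists x.
- apply definable_not, definable_ex.
  + intros s x y; now rewrite h.
  + now apply definable_not.
Qed.

Lemma definable_var_in k i j : definable k (fun s => s i ∈ s j).
Proof. destruct some_class as [A _]; exists (FIn i j), (fun _ => A); cbn; tauto. Qed.

Lemma definable_var_eq k i j : definable k (fun s => s i = s j).
Proof. destruct some_class as [A _]; exists (FEq i j), (fun _ => A); cbn; tauto. Qed.

Lemma definable_var_cls k i A : definable k (fun s => s i ∈∈ A).
Proof. exists (FInC i 0), (fun _ => A); cbn; tauto. Qed.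

Lemma definable_var_upair k i j l : definable k (fun s => is_upair (s i) (s j) (s l)).
Proof.
set (n := S (i + j + l)).
apply definable_iff with (P := fun s => ~ exists x,
  ~ (upd s n x n ∈ upd s n x i <->
     upd s n x n = upd s n x j \/ upd s n x n = upd s n x l)).
- intros s; split.
  + intros h x; apply NNPP; intros hx; apply h; exists x.
    now rewrite upd_eq, !upd_neq by lia.
  + intros h [x hx]; apply hx; rewrite upd_eq, !upd_neq by lia; apply h.
- apply definable_not.
  apply (definable_upd n (P := fun s => ~ (s n ∈ s i <-> s n = s j \/ s n = s l))).
  auto using definable_not, definable_equiv, definable_or, definable_var_in,
    definable_var_eq.
Qed.

Lemma definable_var_pair k i j l : definable k (fun s => s i = pr (s j) (s l)).
Proof.
set (n := S (i + j + l)).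
apply definable_iff with (P := fun s => exists c, exists d,
  let s' := upd (upd s n c) (S n) d in
  is_upair (s' n) (s' j) (s' j) /\ is_upair (s' (S n)) (s' j) (s' l) /\
  is_upair (s' i) (s' n) (s' (S n))).
- intros s; rewrite <- is_pairE; unfold is_pair; cbv zeta.
  split; intros (c & d & H); exists c, d; revert H;
    rewrite upd_eq, (upd_neq _ _ (i := n)), upd_eq, !upd_neq by lia; auto.
- apply (definable_upd n (P := fun s => exists d, let s' := upd s (S n) d in
    is_upair (s' n) (s' j) (s' j) /\ is_upair (s' (S n)) (s' j) (s' l) /\
    is_upair (s' i) (s' n) (s' (S n)))); cbv zeta.
  apply (definable_upd (S n) (P := fun s' =>
    is_upair (s' n) (s' j) (s' j) /\ is_upair (s' (S n)) (s' j) (s' l) /\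
    is_upair (s' i) (s' n) (s' (S n)))).
  auto using definable_and, definable_var_upair.
Qed.

(** A formula contains variables only; an expression [f] is eliminated from it by
    quantifying over a fresh variable [n] that is equal to [f]. *)
Definition term k f := forall n, k <= n ->
  (forall s x, f (upd s n x) = f s) /\ definable 0 (fun s => s n = f s).

Lemma term_var k i : i < k -> term k (fun s => s i).
Proof.
intros hi n hn; split; [intros; apply upd_neq; lia|apply definable_var_eq].
Qed.

Lemma term_const k c : term k (fun _ => c).
Proof.
intros n _; split; [reflexivity|].
destruct (gb_pairing hGB c c) as [a ha], (gb_set_cls hGB a) as [A hA].
apply definable_iff with (P := fun s => s n ∈∈ A); [|apply definable_var_cls].
intros s; rewrite hA, (ha (s n)); tauto.
Qed.

Lemma definable_bind k n f (P : (nat -> vset M) -> vset M -> Prop) :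
  k <= n -> term k f -> (forall s x y, P (upd s n x) y <-> P s y) ->
  definable k (fun s => P s (s n)) -> definable k (fun s => P s (f s)).
Proof.
intros hn hf h hP; destruct (hf n hn) as [h1 h2].
apply definable_iff with (P := fun s => exists x, upd s n x n = f (upd s n x) /\
  P (upd s n x) (upd s n x n)).
- intros s; split.
  + intros (x & e & hx); apply h in hx; now rewrite e, h1 in hx.
  + intros hs; exists (f s); rewrite upd_eq, h1; now split; [|apply h].
- apply (definable_upd n (P := fun s => s n = f s /\ P s (s n))).
  now apply definable_and.
Qed.

Lemma term_pr k f g : term k f -> term k g -> term k (fun s => pr (f s) (g s)).
Proof.
intros hf hg n hn; destruct (hf n hn) as [f1 _], (hg n hn) as [g1 _]; split.
- intros s x; now rewrite f1, g1.
- apply (@definable_bind k (S n) f (fun s x => s n = pr x (g s))); [lia|auto| |].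
  + intros s x y; rewrite upd_neq by lia.
    now rewrite (proj1 (hg (S n) ltac:(lia))).
  + apply (@definable_bind k (S (S n)) g (fun s x => s n = pr (s (S n)) x));
      [lia|auto| |apply definable_var_pair].
    intros s x y; now rewrite !upd_neq by lia.
Qed.

(** A definable relation is turned into a class at once and then serves as an
    atom, through its class as parameter; this keeps formulas small. *)
Definition Cls1 (K : vset M -> Prop) := exists A, forall x, x ∈∈ A <-> K x.
Definition Cls2 (R : vset M -> vset M -> Prop) :=
  exists A, forall x y, pr x y ∈∈ A <-> R x y.
Definition Cls3 (R : vset M -> vset M -> vset M -> Prop) :=
  exists A, forall x y z, pr x (pr y z) ∈∈ A <-> R x y z.

Lemma definable_cls1 k K f : Cls1 K -> term k f -> definable k (fun s => K (f s)).
Proof.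
intros [A hA] hf.
apply (@definable_bind k k f (fun _ x => K x)); try tauto; [lia|].
apply definable_iff with (P := fun s => s k ∈∈ A); [intros; apply hA|].
apply definable_var_cls.
Qed.

Lemma definable_cls2 k R f g :
  Cls2 R -> term k f -> term k g -> definable k (fun s => R (f s) (g s)).
Proof.
intros [A hA] hf hg.
apply definable_iff with (P := fun s => pr (f s) (g s) ∈∈ A); [intros; apply hA|].
apply (@definable_cls1 k (fun x => x ∈∈ A)); [now exists A|now apply term_pr].
Qed.

Lemma definable_cls3 k R f g (h : (nat -> vset M) -> vset M) :
  Cls3 R -> term k f -> term k g -> term k h ->
  definable k (fun s => R (f s) (g s) (h s)).
Proof.
intros [A hA] hf hg hh.
apply definable_iff with (P := fun s => pr (f s) (pr (g s) (h s)) ∈∈ A);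
  [intros; apply hA|].
apply (@definable_cls1 k (fun x => x ∈∈ A)); [now exists A|].
auto using term_pr.
Qed.

Lemma comprehension k P s n : definable k P -> Cls1 (fun x => P (upd s n x)).
Proof.
intros (phi & t & H); destruct (gb_comprehension hGB phi s t n) as [A hA].
exists A; intros x; now rewrite hA, H.
Qed.

Lemma comprehension_var k n K : definable k (fun s => K (s n)) -> Cls1 K.
Proof.
intros h; destruct (gb_infinity hGB) as [a _].
destruct (comprehension (fun _ => a) n h) as [A hA]; exists A.
intros x; now rewrite hA, upd_eq.
Qed.

Lemma Cls1_intro K : definable 1 (fun s => K (s 0)) -> Cls1 K.
Proof. apply comprehension_var. Qed.

Lemma Cls3_intro R : definable 3 (fun s => R (s 0) (s 1) (s 2)) -> Cls3 R.
Proof.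
intros hR.
assert (Cls1 (fun w => exists x y z, w = pr x (pr y z) /\ R x y z)) as [A hA].
- apply (@comprehension_var 4 3).
  apply (definable_upd 0 (P := fun s => exists y z,
    s 3 = pr (s 0) (pr y z) /\ R (s 0) y z)).
  apply (definable_upd 1 (P := fun s => exists z,
    s 3 = pr (s 0) (pr (s 1) z) /\ R (s 0) (s 1) z)).
  apply (definable_upd 2 (P := fun s =>
    s 3 = pr (s 0) (pr (s 1) (s 2)) /\ R (s 0) (s 1) (s 2))).
  apply definable_and; [|exact hR].
  assert (ht : term 4 (fun s => pr (s 0) (pr (s 1) (s 2))))
    by (repeat apply term_pr; apply term_var; lia).
  apply (@definable_bind 4 4 _ (fun s x => s 3 = x)); [lia|exact ht| |].
  + intros s x y; now rewrite upd_neq by lia.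
  + apply definable_var_eq.
- exists A; intros x y z; rewrite hA; split.
  + intros (x' & y' & z' & e & h).
    now apply pr_inj in e as [-> e]; apply pr_inj in e as [-> ->].
  + intros h; now exists x, y, z.
Qed.

Lemma Cls2_intro R : definable 2 (fun s => R (s 0) (s 1)) -> Cls2 R.
Proof.
intros hR.
assert (Cls1 (fun w => exists x y, w = pr x y /\ R x y)) as [A hA].
- apply (@comprehension_var 3 2).
  apply (definable_upd 0 (P := fun s => exists y, s 2 = pr (s 0) y /\ R (s 0) y)).
  apply (definable_upd 1 (P := fun s => s 2 = pr (s 0) (s 1) /\ R (s 0) (s 1))).
  apply definable_and; [apply definable_var_pair|exact hR].
- exists A; intros x y; rewrite hA; split.
  + intros (x' & y' & e & h); now apply pr_inj in e as [-> ->].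
  + intros h; now exists x, y.
Qed.

Lemma Cls2_in : Cls2 (fun x y => x ∈ y).
Proof. apply Cls2_intro, definable_var_in. Qed.

Lemma Cls2_eq : Cls2 (fun x y => x = y).
Proof. apply Cls2_intro, definable_var_eq. Qed.

Lemma Cls1_cmem A : Cls1 (fun x => x ∈∈ A).
Proof. now exists A. Qed.

Lemma Cls2_pair_in A : Cls2 (fun x y => pair_in x y (celts A)).
Proof. exists A; intros x y; symmetry; apply pair_inE. Qed.

Lemma Cls3_triple_in A : Cls3 (fun x y z => triple_in x y z (celts A)).
Proof. exists A; intros x y z; symmetry; apply triple_inE. Qed.

Lemma Cls3_is_pair : Cls3 (fun z x y => is_pair z x y).
Proof.
destruct (@Cls3_intro (fun z x y => z = pr x y)) as [A hA].
- apply definable_bind with (k := 3) (n := 3) (P := fun s x => s 0 = x)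
    (f := fun s => pr (s 1) (s 2));
    [lia|apply term_pr; apply term_var; lia| |apply definable_var_eq].
  intros s x y; now rewrite upd_neq by lia.
- exists A; intros z x y; rewrite hA; symmetry; apply is_pairE.
Qed.

End Definability.

Create HintDb cls.
#[export] Hint Resolve Cls2_in Cls2_eq Cls1_cmem Cls2_pair_in Cls3_triple_in
  Cls3_is_pair : cls.

Ltac solve_term :=
  lazymatch goal with
  | |- term _ (fun s => s ?i) => apply term_var; repeat constructor
  | |- term _ (fun _ => ?c) => apply term_const
  | |- term _ (fun s => pr (@?f s) (@?g s)) => apply (term_pr (f:=f) (g:=g)); solve_term
  end.

(** Proves that an explicitly first-order relation is definable; its atoms are
    constants or relations with a known class, applied to pairs of variables. *)
Ltac define :=
  lazymatch goal with
  | |- definable _ (fun _ => ?p) => apply definable_const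
  | |- definable _ (fun s => @?P s /\ @?Q s) =>
      apply (definable_and (P:=P) (Q:=Q)); define
  | |- definable _ (fun s => @?P s \/ @?Q s) =>
      apply (definable_or (P:=P) (Q:=Q)); define
  | |- definable _ (fun s => @?P s <-> @?Q s) =>
      apply (definable_equiv (P:=P) (Q:=Q)); define
  | |- definable _ (fun s => ~ @?P s) => apply (definable_not (P:=P)); define
  | |- definable _ (fun s => @?P s -> @?Q s) =>
      apply (definable_imp (P:=P) (Q:=Q)); define
  | |- definable ?k (fun s => exists x, @?P s x) =>
      apply (definable_ex (k:=k) (P:=P)); [exact (fun _ _ _ => eq_refl)|cbv beta; define]
  | |- definable ?k (fun s => forall x, @?P s x) =>
      apply (definable_all (k:=k) (P:=P)); [exact (fun _ _ _ => eq_refl)|cbv beta; define]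
  | |- definable ?k (fun s => pair_in (@?f s) (@?g s) (celts ?A)) =>
      apply (definable_cls2 (f:=f) (g:=g) (Cls2_pair_in A)); solve_term
  | |- definable ?k (fun s => triple_in (@?f s) (@?g s) (@?h s) (celts ?A)) =>
      apply (definable_cls3 (f:=f) (g:=g) (h:=h) (Cls3_triple_in A)); solve_term
  | |- definable ?k (fun s => @eq _ (@?f s) (@?g s)) =>
      apply (definable_cls2 (f:=f) (g:=g) Cls2_eq); solve_term
  | _ => define_atom
  end
with define_atom :=
  match goal with
  | |- definable ?k (fun s => ?R (@?f s) (@?g s) (@?h s)) =>
      apply (definable_cls3 (R:=R) (f:=f) (g:=g) (h:=h)); [solve [eauto with cls]|solve_term..]
  | |- definable ?k (fun s => ?R (@?f s) (@?g s)) =>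
      apply (definable_cls2 (R:=R) (f:=f) (g:=g)); [solve [eauto with cls]|solve_term..]
  | |- definable ?k (fun s => ?R (@?f s)) =>
      apply (definable_cls1 (K:=R) (f:=f)); [solve [eauto with cls]|solve_term..]
  | |- definable ?k (fun s => ?R (@?f s) (@?g s) ?c) =>
      apply (definable_cls2 (R:=fun x y => R x y c) (f:=f) (g:=g));
        [solve [eauto with cls]|solve_term..]
  | |- definable ?k (fun s => ?R (@?f s) ?c) =>
      apply (definable_cls1 (K:=fun x => R x c) (f:=f));
        [solve [eauto with cls]|solve_term..]
  end.

(** * Sets *)

Section Sets.
Context {M : structure} {hGB : GB M}.
Implicit Types (a b c x y z : vset M) (R : vset M -> vset M -> Prop).

Lemma separation K a : Cls1 K -> exists b, forall x, x ∈ b <-> x ∈ a /\ K x.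
Proof.
intros [A hA]; destruct (gb_separation hGB a A) as [b hb].
exists b; intros x; now rewrite hb, hA.
Qed.

(** A form of Collection for partial relations that also discards irrelevant
    values; in the absence of choice it replaces the selection of witnesses. *)
Lemma collection a R : Cls2 R -> exists b,
  (forall x, x ∈ a -> (exists y, R x y) -> exists y, y ∈ b /\ R x y) /\
  (forall y, y ∈ b -> exists x, x ∈ a /\ R x y).
Proof.
intros hR; assert (hR' := hR); destruct hR' as [A hA].
destruct (@separation (fun x => exists y, R x y) a) as [a' ha'].
{ apply Cls1_intro; define. }
destruct (gb_collection hGB (a:=a') (R:=A)) as [b hb].
{ intros x [_ [y hy]]%ha'; exists y; apply pair_inE, hA, hy. }
destruct (@separation (fun y => exists x, x ∈ a /\ R x y) b) as [b' hb'].
{ apply Cls1_intro; define. }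
exists b'; split; [|intros y hy; now apply hb'].
intros x hx hy; destruct (hb x) as (y & hyb & h); [now apply ha'|].
apply pair_inE, hA in h; exists y; split; [|exact h].
apply hb'; split; [exact hyb|now exists x].
Qed.

Lemma replacement a R : Cls2 R ->
  (forall x y y', x ∈ a -> R x y -> R x y' -> y = y') ->
  exists b, forall y, y ∈ b <-> exists x, x ∈ a /\ R x y.
Proof.
intros hR hf; destruct (collection a hR) as (b & h1 & h2).
exists b; intros y; split; [apply h2|intros (x & hx & hxy)].
destruct (h1 x hx) as (y' & hy' & hxy'); [now exists y|].
now rewrite (hf x y y').
Qed.

Lemma union2 a b : exists c, forall x, x ∈ c <-> x ∈ a \/ x ∈ b.
Proof.
destruct (gb_pairing hGB a b) as [d hd], (gb_union hGB d) as [c hc].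
exists c; intros x; rewrite hc; split.
- intros (y & [-> | ->]%hd & h); auto.
- intros [h|h]; [exists a|exists b]; (split; [apply hd; auto|exact h]).
Qed.

Lemma singleton a : exists b, forall x, x ∈ b <-> x = a.
Proof.
destruct (gb_pairing hGB a a) as [b hb]; exists b; intros x; split.
- intros h; now destruct (proj1 (hb x) h).
- intros ->; apply hb; auto.
Qed.

Lemma domain a : exists b, forall x, x ∈ b <-> exists y, pr x y ∈ a.
Proof.
destruct (@replacement a (fun u x => exists y, u = pr x y)) as [b hb].
- apply Cls2_intro; define.
- intros u x x' _ [y ->] [y' e]; now apply pr_inj in e.
- exists b; intros x; rewrite hb; split.
  + now intros (u & hu & y & ->); exists y.
  + intros [y hy]; now exists (pr x y); split; [|exists y].
Qed.

Lemma range a : exists b, forall y, y ∈ b <-> exists x, pr x y ∈ a.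
Proof.
destruct (@replacement a (fun u y => exists x, u = pr x y)) as [b hb].
- apply Cls2_intro; define.
- intros u y y' _ [x ->] [x' e]; now apply pr_inj in e.
- exists b; intros y; rewrite hb; split.
  + now intros (u & hu & x & ->); exists x.
  + intros [x hx]; now exists (pr x y); split; [|exists x].
Qed.

Lemma product a b : exists c, forall w, w ∈ c <->
  exists x y, x ∈ a /\ y ∈ b /\ w = pr x y.
Proof.
assert (row : forall x, exists s, forall w, w ∈ s <-> exists y, y ∈ b /\ w = pr x y).
{ intros x; apply (@replacement b (fun y w => w = pr x y)).
  - apply Cls2_intro; define.
  - now intros y w w' _ -> ->. }
destruct (@replacement a (fun x s => forall w, w ∈ s <-> exists y, y ∈ b /\ w = pr x y))
  as [d hd].
- apply Cls2_intro; define.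
- intros x s s' _ h h'; apply set_ext; intros w; now rewrite h, h'.
- destruct (gb_union hGB d) as [c hc]; exists c; intros w; rewrite hc; split.
  + intros (s & (x & hx & hs)%hd & hw); apply hs in hw as (y & hy & e).
    now exists x, y.
  + intros (x & y & hx & hy & e); destruct (row x) as [s hs].
    exists s; split; [apply hd; now exists x|apply hs; now exists y].
Qed.

(** Regularity along the relation [exists p, pr z p ∈ y].  The set [a] is enlarged by
    the pairs and singletons that link z to y through ∈.  Each of these has an
    element in the enlarged set, so an ∈-minimal element of it lies in [a]. *)
Lemma regularity_dom a : (exists y, y ∈ a) ->
  exists y, y ∈ a /\ forall z p, pr z p ∈ y -> ~ z ∈ a.
Proof.
intros ha.
destruct (gb_union hGB a) as [a1 h1], (gb_union hGB a1) as [a2 h2].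
destruct (union2 a1 a2) as [a3 h3], (union2 a a3) as [a4 h4].
destruct (@separation (fun w => w ∈ a \/
  (w ∈ a1 /\ exists z p, z ∈ a /\ w = pr z p) \/
  (exists z, z ∈ a /\ is_upair w z z)) a4) as [b hb].
{ apply Cls1_intro; unfold is_upair; define. }
destruct (gb_regularity hGB (a:=b)) as (m & hm & hmin).
{ destruct ha as [y hy]; exists y; apply hb; split; [apply h4|]; auto. }
destruct (proj1 (hb m) hm) as [_ [hma|[(hm1 & z & p & hz & ->)|(z & hz & h)]]].
- exists m; split; [exact hma|intros z p hp hz].
  assert (pr z p ∈ a1) by (apply h1; now exists m).
  apply (hmin (pr z p)); [|exact hp].
  apply hb; split; [apply h4; right; apply h3; now left|].
  right; left; split; [assumption|now exists z, p].
- destruct (pr_spec z p) as (c & d & hc & _ & hcp); exfalso.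
  assert (c ∈ pr z p) by (apply hcp; auto).
  apply (hmin c); [|assumption].
  apply hb; split; [|right; right; now exists z].
  apply h4; right; apply h3; right; apply h2; now exists (pr z p).
- exfalso; apply (hmin z); [|apply h; auto].
  apply hb; split; [apply h4|]; auto.
Qed.

End Sets.

(** * Names *)

Section Names.
Context {M : structure} {hGB : GB M}.
Implicit Types (a b c x y z p t : vset M) (K Q : vset M -> Prop).
Variable (PP : forcing_triple M).

Lemma Cls1_hereditarily Q : Cls1 Q -> Cls1 (hereditarily PP Q).
Proof.
intros hQ; apply Cls1_intro; unfold hereditarily, name_over, elts; define.
Qed.

Lemma hereditarily_elim Q x : hereditarily PP Q x -> Q x /\
  forall u, u ∈ x -> exists z p, u = pr z p /\ hereditarily PP Q z /\ p ∈∈ cond PP.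
Proof.
intros (t & hx & ht); split; [now apply ht|intros u hu].
destruct (proj2 (ht x hx) u hu) as (z & p & hz%is_pairE & hzt & hp).
exists z, p; repeat split; auto; now exists t.
Qed.

Lemma hereditarily_pr Q x z p :
  hereditarily PP Q x -> pr z p ∈ x -> hereditarily PP Q z /\ p ∈∈ cond PP.
Proof.
intros [_ h]%hereditarily_elim hz.
now destruct (h _ hz) as (z' & p' & [-> ->]%pr_inj & H).
Qed.

(** Each element of [x] comes with many sets witnessing the recursion; the union of
    a collected family of such witnesses is again a witness. *)
Lemma hereditarily_intro Q x : Cls1 Q -> Q x ->
  (forall u, u ∈ x ->
    exists z p, u = pr z p /\ hereditarily PP Q z /\ p ∈∈ cond PP) ->
  hereditarily PP Q x.
Proof.
intros hQ hx h.
set (wit t := forall y, y ∈ t -> Q y /\ name_over PP (elts t) (elts y)).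
destruct (@collection _ _ x (fun u t => wit t /\ exists z p, u = pr z p /\ z ∈ t))
  as (B & hB & hB').
{ apply Cls2_intro; unfold wit, name_over, elts; define. }
destruct (gb_union hGB B) as [T hT], (singleton x) as [s hs], (union2 T s) as [T' hT'].
exists T'; split; [apply hT'; right; now apply hs|].
intros y [(t & ht & hy)%hT | ->%hs]%hT'.
- destruct (hB' t ht) as (_ & _ & hw & _), (hw y hy) as [hQy hn].
  split; [exact hQy|intros u hu].
  destruct (hn u hu) as (z & p & hu' & hz & hp); exists z, p; repeat split; auto.
  apply hT'; left; apply hT; now exists t.
- split; [exact hx|intros u hu].
  destruct (h u hu) as (z & p & e & (t & hzt & ht) & hp).
  destruct (hB u hu) as (t' & ht' & _ & z' & p' & e' & hz').
  { exists t; split; [exact ht|now exists z, p]. }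
  rewrite e in e'; apply pr_inj in e' as [<- _].
  exists z, p; repeat split; [now apply is_pairE| |exact hp].
  apply hT'; left; apply hT; now exists t'.
Qed.

(** A counterexample lies in a set closed under passing to the names inside a
    name, so that [regularity_dom] yields a minimal one. *)
Lemma hereditarily_ind Q K : Cls1 K ->
  (forall x, hereditarily PP Q x -> (forall z p, pr z p ∈ x -> K z) -> K x) ->
  forall x, hereditarily PP Q x -> K x.
Proof.
intros hK h x (t & hx & ht); apply NNPP; intros hn.
destruct (@separation _ _ (fun y => ~ K y) t) as [bad hbad].
{ apply Cls1_intro; define. }
destruct (@regularity_dom _ _ bad) as (y & hy & hmin); [exists x; now apply hbad|].
apply hbad in hy as [hyt hy]; apply hy, h; [now exists t|intros z p hz].
apply NNPP; intros hKz; apply (hmin z p hz), hbad; split; [|exact hKz].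
destruct (proj2 (ht y hyt) _ hz) as (z' & p' & e%is_pairE & hz' & _).
now apply pr_inj in e as [-> _].
Qed.

Lemma hereditarily_weaken Q Q' x : (forall y, Q y -> Q' y) ->
  hereditarily PP Q x -> hereditarily PP Q' x.
Proof.
intros h (t & hx & ht); exists t; split; [exact hx|intros y hy].
destruct (ht y hy); auto.
Qed.

Lemma Cls1_set_name : Cls1 (set_name PP).
Proof. apply Cls1_hereditarily, Cls1_intro, definable_const. Qed.

Lemma set_name_intro x :
  (forall u, u ∈ x -> exists z p, u = pr z p /\ set_name PP z /\ p ∈∈ cond PP) ->
  set_name PP x.
Proof. apply hereditarily_intro; [apply Cls1_intro, definable_const|exact I]. Qed.

End Names.
#[export] Hint Resolve Cls1_hereditarily Cls1_set_name : cls.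

(** * The action of automorphisms on names *)

Section Action.
Context {M : structure} {hGB : GB M}.
Implicit Types (a b c u v w x y z p q f : vset M) (X Y Z : vcls M).

(** [moves] for sets, with the automorphism replaced by an arbitrary relation [A] so
    that it also applies to the family of all π_d, given by one class. *)
Definition moved (A : vset M -> vset M -> Prop) (R : vset M -> vset M -> Prop) x y :=
  forall w, w ∈ y <-> exists z p z' p', pr z p ∈ x /\ R z z' /\ A p p' /\ w = pr z' p'.

Definition name_map A f := forall u v, pr u v ∈ f ->
  moved A (fun z z' => pr z z' ∈ f) u v /\
  forall z p, pr z p ∈ u -> exists z', pr z z' ∈ f.

Definition at_pair X p p' := pr p p' ∈∈ X.

Lemma movesE X R x (L : vset M -> Prop) : moves X R (elts x) L <->
  forall w, L w <-> exists z p z' p', pr z p ∈ x /\ R z z' /\ pr p p' ∈∈ X /\ w = pr z' p'.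
Proof.
unfold moves.
split; intros h w; rewrite (h w); clear h; split; intros (z & p & z' & p' & h);
  exists z, p, z', p'; rewrite ?pair_inE, ?is_pairE in *; exact h.
Qed.

Lemma actE X x y :
  act X x y <-> exists f, pr x y ∈ f /\ name_map (at_pair X) f.
Proof.
unfold act, name_map; split; intros (f & hf & h); exists f;
  (split; [now apply pair_inE in hf || apply pair_inE|]); intros u v huv.
- destruct (h u v) as [h1 h2]; [now apply pair_inE|]; split.
  + rewrite movesE in h1; intros w; rewrite (h1 w).
    split; intros (z & p & z' & p' & H); exists z, p, z', p'; rewrite pair_inE in *; exact H.
  + intros z p hz; destruct (h2 z p) as [z' hz']; [now apply pair_inE|].
    exists z'; now apply pair_inE in hz'.
- apply pair_inE in huv; destruct (h u v huv) as [h1 h2]; split.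
  + rewrite movesE; intros w; unfold elts; rewrite (h1 w).
    split; intros (z & p & z' & p' & H); exists z, p, z', p'; rewrite pair_inE in *; exact H.
  + intros z p hz; apply pair_inE in hz; destruct (h2 z p hz) as [z' hz'].
    exists z'; now apply pair_inE.
Qed.

Lemma Cls2_act X : Cls2 (act X).
Proof.
destruct (@Cls2_intro _ _ (fun x y => exists f, pr x y ∈ f /\ name_map (at_pair X) f))
  as [A hA].
{ unfold name_map, moved, at_pair; define. }
exists A; intros x y; now rewrite hA, actE.
Qed.

(** Two recursions along a name agree as soon as the automorphisms agree on the
    conditions occurring in it. *)
Lemma name_map_agree (A A' : vset M -> vset M -> Prop) f f' t :
  name_map A f -> name_map A' f' ->
  (forall u z p, u ∈ t -> pr z p ∈ u -> z ∈ t /\ forall p', A p p' <-> A' p p') ->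
  forall x y y', x ∈ t -> pr x y ∈ f -> pr x y' ∈ f' -> y = y'.
Proof.
intros hf hf' ht x y y' hx hy hy'; apply NNPP; intros hne.
destruct (@separation _ _ (fun u => exists v v', pr u v ∈ f /\ pr u v' ∈ f' /\ ~ v = v') t)
  as [bad hbad]; [apply Cls1_intro; define|].
destruct (@regularity_dom _ _ bad) as (u & hu & hmin).
{ exists x; apply hbad; split; [exact hx|now exists y, y']. }
apply hbad in hu as (hut & v & v' & hv & hv' & hvv'); apply hvv', set_ext; intros w.
destruct (hf u v hv) as [h1 h2], (hf' u v' hv') as [h1' h2'].
rewrite (h1 w), (h1' w).
assert (hz : forall z p, pr z p ∈ u -> exists z', pr z z' ∈ f /\ pr z z' ∈ f' /\
  forall z'', pr z z'' ∈ f \/ pr z z'' ∈ f' -> z'' = z').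
{ intros z p hz; destruct (h2 z p hz) as [z1 hz1], (h2' z p hz) as [z2 hz2].
  assert (H : forall z3 z4, pr z z3 ∈ f -> pr z z4 ∈ f' -> z3 = z4).
  { intros z3 z4 hz3 hz4; apply NNPP; intros hn; apply (hmin z p hz), hbad.
    split; [now apply (ht u z p)|now exists z3, z4]. }
  assert (z1 = z2) as <- by auto.
  exists z1; repeat split; auto; intros z'' [h|h]; auto; symmetry; auto. }
split; intros (z & p & z' & p' & hzp & hzz & hpp & ->); exists z, p, z', p';
  destruct (hz z p hzp) as (z1 & hz1 & hz1' & H), (ht u z p hut hzp) as [_ hA];
  (split; [exact hzp|]); (split; [rewrite (H z') by auto; assumption|]);
  (split; [now apply hA|reflexivity]).
Qed.

Lemma act_agree X X' t x y y' :
  (forall u z p, u ∈ t -> pr z p ∈ u ->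
     z ∈ t /\ forall p', pr p p' ∈∈ X <-> pr p p' ∈∈ X') ->
  x ∈ t -> act X x y -> act X' x y' -> y = y'.
Proof.
intros ht hx (f & hf & h)%actE (f' & hf' & h')%actE.
exact (name_map_agree h h' ht hx hf hf').
Qed.

Lemma name_map_fun A f f' x y y' : name_map A f -> name_map A f' ->
  pr x y ∈ f -> pr x y' ∈ f' -> y = y'.
Proof.
intros h h' hy hy'; destruct (domain f) as [t ht].
apply (name_map_agree h h' (t := t)) with (x := x); auto.
- intros u z p [v hv]%ht hz; split; [|tauto]; apply ht.
  exact (proj2 (h u v hv) z p hz).
- apply ht; now exists y.
Qed.

Lemma act_fun X x y y' : act X x y -> act X x y' -> y = y'.
Proof.
intros (f & hf & h)%actE (f' & hf' & h')%actE; exact (name_map_fun h h' hf hf').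
Qed.

Lemma act_elim X x y : act X x y ->
  moved (at_pair X) (act X) x y /\ forall z p, pr z p ∈ x -> exists z', act X z z'.
Proof.
intros (f & hf & h)%actE.
assert (hfa : forall z z', pr z z' ∈ f -> act X z z')
  by (intros z z' hz; apply actE; now exists f).
destruct (h x y hf) as [h1 h2]; split.
- intros w; rewrite (h1 w); split; intros (z & p & z' & p' & hz & hzz & hp & e);
    exists z, p, z', p'; repeat split; auto.
  destruct (h2 z p hz) as [z'' hz'']; now rewrite (act_fun hzz (hfa _ _ hz'')).
- intros z p hz; destruct (h2 z p hz) as [z' hz']; exists z'; auto.
Qed.

(** The recursion defining the action exists.  The recursions along the names
    inside [x] are not chosen but collected; by [name_map_fun] they are
    compatible, so that their union is a recursion, which is extended to [x]. *)
Lemma act_intro X x y : (forall z p, pr z p ∈ x -> exists z', act X z z') ->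
  moved (at_pair X) (act X) x y -> act X x y.
Proof.
intros hdom hy; destruct (domain x) as [d hd].
destruct (@collection _ _ d (fun z f => name_map (at_pair X) f /\ exists z', pr z z' ∈ f))
  as (B & hB & hB').
{ apply Cls2_intro; unfold name_map, moved, at_pair; define. }
destruct (gb_union hGB B) as [f0 hf0].
assert (hact : forall z z', pr z z' ∈ f0 -> act X z z').
{ intros z z' (f & hf & hz)%hf0; apply actE; exists f.
  destruct (hB' f hf) as (? & _ & hm & _); now split. }
assert (hdef : forall z p, pr z p ∈ x -> exists z', pr z z' ∈ f0).
{ intros z p hz; destruct (hdom z p hz) as (z' & (f & hf & hm)%actE).
  destruct (hB z) as (f1 & hf1 & _ & z1 & hz1).
  - apply hd; now exists p.
  - exists f; split; [exact hm|now exists z'].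
  - exists z1; apply hf0; now exists f1. }
assert (hm0 : name_map (at_pair X) f0).
{ intros u v (f & hf & huv)%hf0; destruct (hB' f hf) as (? & _ & hm & _).
  destruct (hm u v huv) as [h1 h2]; split.
  - intros w; rewrite (h1 w); split; intros (z & p & z' & p' & hz & hzz & hp & e);
      exists z, p, z', p'; repeat split; auto.
    + apply hf0; now exists f.
    + destruct (h2 z p hz) as [z1 hz1]; rewrite (act_fun (hact _ _ hzz) (y' := z1)); auto.
      apply hact, hf0; now exists f.
  - intros z p hz; destruct (h2 z p hz) as [z1 hz1]; exists z1; apply hf0; now exists f. }
destruct (classic (exists y1, pr x y1 ∈ f0)) as [[y1 hy1]|hx].
- assert (y = y1) as ->; [|now apply hact].
  apply set_ext; intros w; rewrite (hy w); symmetry.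
  apply (proj1 (act_elim (hact _ _ hy1)) w).
- destruct (singleton (pr x y)) as [s hs], (union2 f0 s) as [f1 hf1].
  apply actE; exists f1; split; [apply hf1; right; now apply hs|].
  assert (hz1 : forall z p z', pr z p ∈ x -> pr z z' ∈ f1 <-> pr z z' ∈ f0).
  { intros z p z' hz; rewrite hf1, hs; split; [|auto]; intros [h|[-> ->]%pr_inj]; auto.
    now destruct hx; apply (hdef x p). }
  intros u v [huv|[-> ->]%hs%pr_inj]%hf1.
  + destruct (hm0 u v huv) as [h1 h2]; split.
    * intros w; rewrite (h1 w); split; intros (z & p & z' & p' & hz & hzz & hp & e);
        exists z, p, z', p'; repeat split; auto; [apply hf1; now left|].
      apply hf1 in hzz as [hzz|[-> ->]%hs%pr_inj]; auto.
      destruct hx; exact (h2 x p hz).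
    * intros z p hz; destruct (h2 z p hz) as [z' hz']; exists z'; apply hf1; auto.
  + split.
    * intros w; rewrite (hy w); split; intros (z & p & z' & p' & hz & hzz & hp & e);
        exists z, p, z', p'; repeat split; auto.
      -- apply hf1; left; destruct (hdef z p hz) as [z1 h1].
         now rewrite (act_fun hzz (hact _ _ h1)).
      -- apply hact, (hz1 z p z' hz), hzz.
    * intros z p hz; destruct (hdef z p hz) as [z' hz']; exists z'; apply hf1; auto.
Qed.

Lemma act_pr X x y z p z' p' : act X x y -> pr z p ∈ x -> act X z z' ->
  pr p p' ∈∈ X -> pr z' p' ∈ y.
Proof. intros h hz hzz hp; apply (proj1 (act_elim h)); now exists z, p, z', p'. Qed.

Lemma act_inv_pr X x y w : act X x y -> w ∈ y -> exists z p z' p',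
  pr z p ∈ x /\ act X z z' /\ pr p p' ∈∈ X /\ w = pr z' p'.
Proof. intros h hw; now apply (proj1 (act_elim h)). Qed.

Variable (PP : forcing_triple M).
#[local] Hint Resolve Cls2_act : cls.

Section OneAutomorphism.
Context {X : vcls M} (hX : automorphism PP X).

Lemma aut_cond p q : pr p q ∈∈ X -> p ∈∈ cond PP /\ q ∈∈ cond PP.
Proof.
intros h; destruct hX as [h1 _], (h1 _ h) as (p' & q' & e & H).
apply is_pairE in e; now apply pr_inj in e as [-> ->].
Qed.

Lemma aut_total p : p ∈∈ cond PP -> exists q, pr p q ∈∈ X.
Proof.
intros h; destruct hX as (_ & h1 & _), (h1 p h) as (q & hq & _).
exists q; now apply pair_inE in hq.
Qed.

Lemma aut_onto q : q ∈∈ cond PP -> exists p, pr p q ∈∈ X.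
Proof.
intros h; destruct hX as (_ & _ & h1 & _), (h1 q h) as (p & hp & _).
exists p; now apply pair_inE in hp.
Qed.

Lemma aut_fun p q q' : pr p q ∈∈ X -> pr p q' ∈∈ X -> q = q'.
Proof.
intros h h'; destruct hX as (_ & h1 & _), (h1 p) as (q0 & _ & hq).
- now apply aut_cond in h.
- rewrite <- (hq q), <- (hq q'); auto; now apply pair_inE.
Qed.

Lemma aut_inj p p' q : pr p q ∈∈ X -> pr p' q ∈∈ X -> p = p'.
Proof.
intros h h'; destruct hX as (_ & _ & h1 & _), (h1 q) as (p0 & _ & hp).
- now apply aut_cond in h.
- rewrite <- (hp p), <- (hp p'); auto; now apply pair_inE.
Qed.

Lemma aut_le p q p' q' : pr p p' ∈∈ X -> pr q q' ∈∈ X -> le PP p q <-> le PP p' q'.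
Proof.
intros h h'; destruct hX as (_ & _ & _ & H); apply H; now apply pair_inE.
Qed.

Lemma act_total x : set_name PP x -> exists y, act X x y.
Proof.
revert x; apply hereditarily_ind; [apply Cls1_intro; define|].
intros x hx IH.
destruct (@replacement _ _ x (fun u w => exists z p z' p',
  u = pr z p /\ act X z z' /\ pr p p' ∈∈ X /\ w = pr z' p')) as [y hy].
- apply Cls2_intro; define.
- intros u w w' _ (z & p & z' & p' & -> & hz & hp & ->)
    (z1 & p1 & z1' & p1' & [<- <-]%pr_inj & hz1 & hp1 & ->).
  now rewrite (act_fun hz hz1), (aut_fun hp hp1).
- exists y; apply act_intro; [exact IH|intros w; rewrite hy; split].
  + intros (u & hu & z & p & z' & p' & -> & H); now exists z, p, z', p'.
  + intros (z & p & z' & p' & hz & H); exists (pr z p); split; [exact hz|].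
    now exists z, p, z', p'.
Qed.

Lemma act_set_name x y : set_name PP x -> act X x y -> set_name PP y.
Proof.
intros hx; revert x hx y.
apply (@hereditarily_ind _ _ PP _ (fun x => forall y, act X x y -> set_name PP y)).
- apply Cls1_intro; define.
- intros x hx IH y hy; apply set_name_intro; intros w hw.
  destruct (act_inv_pr hy hw) as (z & p & z' & p' & hz & hzz & hp & ->).
  exists z', p'; repeat split; [apply (IH z p hz z' hzz)|now apply aut_cond in hp].
Qed.

End OneAutomorphism.

Lemma act_id X x : is_id PP X -> set_name PP x -> act X x x.
Proof.
intros hX; revert x.
apply (@hereditarily_ind _ _ PP _ (fun x => act X x x)); [apply Cls1_intro; define|].
assert (hid : forall p q, pr p q ∈∈ X <-> p ∈∈ cond PP /\ q = p).
{ intros p q; rewrite (hX (pr p q)); split.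
  - intros (p' & q' & e%is_pairE & H); now apply pr_inj in e as [-> ->].
  - intros H; exists p, q; now split; [apply pr_spec|]. }
intros x hx IH; apply act_intro; [intros z p hz; exists z; eauto|].
intros w; split.
- intros hw; destruct (proj2 (hereditarily_elim hx) w hw) as (z & p & -> & hz & hp).
  exists z, p, z, p; repeat split; eauto; now apply hid.
- intros (z & p & z' & p' & hz & hzz & [_ ->]%hid & ->).
  now rewrite (act_fun hzz (IH z p hz)).
Qed.

Lemma is_compE Z X Y : is_comp Z X Y -> forall p r,
  pr p r ∈∈ Z <-> exists q, pr p q ∈∈ Y /\ pr q r ∈∈ X.
Proof.
intros h p r; rewrite (h (pr p r)); split.
- intros (p' & r' & e%is_pairE & q & H); apply pr_inj in e as [-> ->].
  rewrite !pair_inE in H; now exists q.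
- intros (q & H); exists p, r; split; [apply pr_spec|exists q].
  now rewrite !pair_inE.
Qed.

Lemma is_invE X Y : is_inv Y X -> forall p q, pr p q ∈∈ Y <-> pr q p ∈∈ X.
Proof.
intros h p q; rewrite (h (pr p q)); split.
- intros (p' & q' & e%is_pairE & H); apply pr_inj in e as [-> ->].
  now apply pair_inE in H.
- intros H; exists p, q; split; [apply pr_spec|now apply pair_inE].
Qed.

Lemma act_comp X Y Z x y z : automorphism PP Y -> is_comp Z X Y -> set_name PP x ->
  act Y x y -> act X y z -> act Z x z.
Proof.
intros hY hZ hx; revert x hx y z.
apply (@hereditarily_ind _ _ PP _
  (fun x => forall y z, act Y x y -> act X y z -> act Z x z)).
{ apply Cls1_intro; define. }
intros x hx IH y z hy hz.
assert (hact : forall u p, pr u p ∈ x -> exists u' q u'', act Y u u' /\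
  pr p q ∈∈ Y /\ pr u' q ∈ y /\ act X u' u'' /\ act Z u u'').
{ intros u p hu; destruct (aut_total hY (proj2 (hereditarily_pr hx hu))) as [q hq].
  destruct (proj2 (act_elim hy) u p hu) as [u' hu'].
  assert (pr u' q ∈ y) by (eapply act_pr; eauto).
  destruct (proj2 (act_elim hz) u' q) as [u'' hu'']; [assumption|].
  exists u', q, u''; eauto 6. }
apply act_intro.
- intros u p hu; destruct (hact u p hu) as (? & ? & u'' & H); exists u''; tauto.
- intros w; split.
  + intros hw; destruct (act_inv_pr hz hw) as (u' & q & u'' & r & hu' & h1 & h2 & ->).
    destruct (act_inv_pr hy hu') as (u & p & u1 & q1 & hu & h3 & h4 & [<- <-]%pr_inj).
    exists u, p, u'', r; repeat split; eauto.
    apply (is_compE hZ); now exists q.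
  + intros (u & p & u'' & r & hu & h1 & h2 & ->).
    destruct (hact u p hu) as (u' & q & u1 & h3 & h4 & h5 & h6 & h7).
    rewrite (act_fun h1 h7); apply (act_pr hz h5 h6).
    apply (is_compE hZ) in h2 as (q1 & h8 & h9); now rewrite (aut_fun hY h4 h8).
Qed.

Lemma act_inv X Y x y : automorphism PP X -> is_inv Y X -> set_name PP x ->
  act X x y -> act Y y x.
Proof.
intros hX hY hx; revert x hx y.
apply (@hereditarily_ind _ _ PP _ (fun x => forall y, act X x y -> act Y y x)).
{ apply Cls1_intro; define. }
intros x hx IH y hy; apply act_intro.
- intros z' p' hz'.
  destruct (act_inv_pr hy hz') as (z & p & z1 & p1 & hz & h1 & _ & [<- <-]%pr_inj).
  exists z; eauto.
- intros w; split.
  + intros hw; destruct (proj2 (hereditarily_elim hx) w hw) as (z & p & -> & _ & hp).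
    destruct (proj2 (act_elim hy) z p hw) as [z' hz'], (aut_total hX hp) as [p' hp'].
    exists z', p', z, p; repeat split; eauto using act_pr.
    now apply (is_invE hY).
  + intros (z' & p' & z & p & hz' & h1 & h2%(is_invE hY) & ->).
    destruct (act_inv_pr hy hz') as (z1 & p1 & z2 & p2 & hz & h3 & h4 & [<- <-]%pr_inj).
    rewrite (act_fun h1 (IH z1 p1 hz z' h3)); now rewrite (aut_inj hX h2 h4).
Qed.

Lemma is_inv_exists X : exists Y, is_inv Y X.
Proof.
destruct (@Cls1_intro _ _ (fun z => exists p q, is_pair z p q /\ pair_in q p (celts X)))
  as [Y hY]; [define|now exists Y].
Qed.

Lemma is_comp_exists X Y : exists Z, is_comp Z X Y.
Proof.
destruct (@Cls1_intro _ _ (fun z => exists p r, is_pair z p r /\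
  exists q, pair_in p q (celts Y) /\ pair_in q r (celts X))) as [Z hZ];
  [define|now exists Z].
Qed.

Lemma is_id_exists : exists X, is_id PP X.
Proof.
destruct (@Cls1_intro _ _ (fun z => exists p q, is_pair z p q /\
  (p ∈∈ cond PP /\ q = p))) as [X hX]; [define|now exists X].
Qed.

End Action.
#[export] Hint Resolve Cls2_act : cls.

(** * Forcing *)

Existing Class class_forcing.

Section Order.
Context {M : structure} {hGB : GB M}.
Context {PP : forcing_triple M} {hPP : class_forcing PP}.
Implicit Types (p q r : vset M).

Lemma Cls2_le : Cls2 (le PP).
Proof. apply Cls2_pair_in. Qed.

Lemma le_cond p q : le PP p q -> p ∈∈ cond PP /\ q ∈∈ cond PP.
Proof.
intros h%pair_inE; destruct (cf_leq hPP h) as (p' & q' & e%is_pairE & H).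
now apply pr_inj in e as [-> ->].
Qed.

Lemma le_refl p : p ∈∈ cond PP -> le PP p p.
Proof. apply (cf_refl hPP). Qed.

Lemma le_trans p q r : le PP p q -> le PP q r -> le PP p r.
Proof. apply (cf_trans hPP). Qed.

End Order.
#[export] Hint Resolve Cls2_le : cls.

(** Closes [le PP p q] by following known inequalities upwards from [p]. *)
Ltac below :=
  first [assumption |
    match goal with
    | H : le ?PP ?p _ |- le ?PP ?p _ => apply (le_trans H); below
    end].

Section Forcing.
Context {M : structure} {hGB : GB M}.
Context {PP : forcing_triple M} {hPP : class_forcing PP}.
Implicit Types (p q r u v x y z : vset M) (K L N : vset M -> Prop).

(** The regular open classes of conditions.  Every formula of the forcing language
    has such a class as truth value, which gives both the monotonicity of the
    forcing relation and the passage from dense below [p] to [p]. *)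
Definition regular K :=
  (forall p q, le PP q p -> K p -> K q) /\
  (forall p, p ∈∈ cond PP -> dense_below PP K p -> K p).

Lemma regular_and K L : regular K -> regular L -> regular (fAnd K L).
Proof.
intros [h1 h2] [h3 h4]; split.
- intros p q hq [hK hL]; split; eauto.
- intros p hp h; split; [apply h2|apply h4]; auto;
    intros s hs; destruct (h s hs) as (q & hq & hK & hL); eauto.
Qed.

Lemma regular_not K : (forall p q, le PP q p -> K p -> K q) -> regular (fNot PP K).
Proof.
intros h; split.
- intros p q hq hn s hs; apply hn; below.
- intros p hp hd s hs hK; destruct (hd s hs) as (q & hq & hn).
  apply (hn q); [apply le_refl; now apply le_cond in hq|eauto].
Qed.

Lemma regular_dense_below K : regular (dense_below PP K).
Proof.
split.
- intros p q hq h s hs; apply h; below.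
- intros p hp hd s hs; destruct (hd s hs) as (q & hq & h).
  destruct (h q) as (r & hr & hK); [apply le_refl; now apply le_cond in hq|].
  exists r; split; [below|exact hK].
Qed.

Lemma regular_ext K L : (forall p, p ∈∈ cond PP -> (K p <-> L p)) ->
  regular K -> regular L.
Proof.
intros h [h1 h2]; split.
- intros p q hq; assert (hc := le_cond hq); rewrite <- !h by tauto; eauto.
- intros p hp hd; apply h, h2; auto; intros s hs.
  destruct (hd s hs) as (q & hq & hL); exists q; split; [exact hq|].
  apply h; [now apply le_cond in hq|exact hL].
Qed.

Lemma fImp_intro K L p : (forall q, le PP q p -> K q -> exists r, le PP r q /\ L r) ->
  fImp PP K L p.
Proof. intros h q hq [hK hn]; destruct (h q hq hK) as (r & hr & hL); exact (hn r hr hL). Qed.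

Lemma fImp_elim K L p q : fImp PP K L p -> le PP q p -> K q ->
  exists r, le PP r q /\ L r.
Proof.
intros h hq hK; apply NNPP; intros hn; apply (h q hq); split; [exact hK|].
intros r hr hL; apply hn; now exists r.
Qed.

Lemma fAll_intro N (K : vset M -> vset M -> Prop) p :
  (forall x, N x -> forall q, le PP q p -> exists r, le PP r q /\ K x r) ->
  fAll PP N K p.
Proof.
intros h q hq he; destruct (he q) as (r & hr & x & hx & hn).
{ apply le_refl; now apply le_cond in hq. }
destruct (h x hx r) as (r' & hr' & hK); [below|].
exact (hn r' hr' hK).
Qed.

Lemma fAll_elim N (K : vset M -> vset M -> Prop) p x q :
  fAll PP N K p -> N x -> le PP q p -> exists r, le PP r q /\ K x r.
Proof.
intros h hx hq; apply NNPP; intros hn; apply (h q hq).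
intros s hs; exists s; split; [apply le_refl; now apply le_cond in hs|].
exists x; split; [exact hx|]; intros r hr hK; apply hn; exists r.
split; [below|exact hK].
Qed.

(** ** Atomic formulas *)

Context {F : atomic M} (hF : atomic_forcing PP (set_name PP) F).
#[local] Notation name := (set_name PP).

Lemma fInE p x y : p ∈∈ cond PP -> name x -> name y -> fIn F p x y <->
  dense_below PP (fun q => exists z r, pr z r ∈ y /\ le PP q r /\ fEq F q x z) p.
Proof.
intros hp hx hy; rewrite (proj1 (hF hp hx hy)); split; intros h s hs;
  destruct (h s hs) as (q & hq & H); exists q; (split; [exact hq|]).
- destruct H as (_ & z & r & hz%pair_inE & H); now exists z, r.
- split; [now apply le_cond in hq|]; destruct H as (z & r & hz & H).
  exists z, r; split; [now apply pair_inE|exact H].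
Qed.

Lemma fSubE p x y : p ∈∈ cond PP -> name x -> name y -> fSub F p x y <->
  forall z r, pr z r ∈ x -> forall s, le PP s p -> le PP s r ->
    exists q, le PP q s /\ fIn F q z y.
Proof.
intros hp hx hy; rewrite (proj1 (proj2 (hF hp hx hy))).
split; intros h z r hz; apply h; now apply pair_inE.
Qed.

Lemma fEqE p x y : p ∈∈ cond PP -> name x -> name y ->
  fEq F p x y <-> fSub F p x y /\ fSub F p y x.
Proof. intros hp hx hy; apply (proj2 (proj2 (hF hp hx hy))). Qed.

Lemma fEq_sym p x y : p ∈∈ cond PP -> name x -> name y -> fEq F p x y -> fEq F p y x.
Proof. intros hp hx hy; rewrite !fEqE by auto; tauto. Qed.

Lemma regular_fIn x y : name x -> name y -> regular (fun p => fIn F p x y).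
Proof.
intros hx hy; eapply regular_ext; [|apply regular_dense_below].
intros p hp; symmetry; now apply fInE.
Qed.

Lemma regular_fSub x y : name x -> name y -> regular (fun p => fSub F p x y).
Proof.
intros hx hy; apply regular_ext with (K := fun p => forall z r, pr z r ∈ x ->
  forall s, le PP s p -> le PP s r -> exists q, le PP q s /\ fIn F q z y).
{ intros p hp; symmetry; now apply fSubE. }
split.
- intros p q hq h z r hz s hs; apply (h z r hz); below.
- intros p hp hd z r hz s hs hsr; destruct (hd s hs) as (q & hq & h).
  destruct (h z r hz q) as (q' & hq' & H); [|below|].
  + apply le_refl; now apply le_cond in hq.
  + exists q'; split; [below|exact H].
Qed.

Lemma regular_fEq x y : name x -> name y -> regular (fun p => fEq F p x y).
Proof.
intros hx hy; eapply regular_ext;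
  [|exact (regular_and (regular_fSub hx hy) (regular_fSub hy hx))].
intros p hp; symmetry; now apply fEqE.
Qed.

Lemma fEq_mono p q x y : name x -> name y -> le PP q p -> fEq F p x y -> fEq F q x y.
Proof. intros hx hy; apply (regular_fEq hx hy). Qed.

Lemma fIn_mono p q x y : name x -> name y -> le PP q p -> fIn F p x y -> fIn F q x y.
Proof. intros hx hy; apply (regular_fIn hx hy). Qed.

Lemma name_pr x z p : name x -> pr z p ∈ x -> name z.
Proof. intros hx hz; exact (proj1 (hereditarily_pr hx hz)). Qed.

Lemma Cls3_fEq : Cls3 (fEq F).
Proof. apply Cls3_triple_in. Qed.

Lemma Cls3_fIn : Cls3 (fIn F).
Proof. apply Cls3_triple_in. Qed.

Lemma Cls3_fSub : Cls3 (fSub F).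
Proof. apply Cls3_triple_in. Qed.
#[local] Hint Resolve Cls3_fEq Cls3_fIn Cls3_fSub : cls.

Lemma fEq_refl p x : p ∈∈ cond PP -> name x -> fEq F p x x.
Proof.
intros hp hx; revert x hx p hp.
apply (@hereditarily_ind _ _ PP _ (fun x => forall p, p ∈∈ cond PP -> fEq F p x x)).
{ apply Cls1_intro; define. }
intros x hx IH p hp; assert (fSub F p x x); [|now apply fEqE].
apply fSubE; auto; intros z r hz s hs hsr; exists s; assert (hc := le_cond hs).
split; [now apply le_refl|].
apply fInE; [tauto|exact (name_pr hx hz)|auto|].
intros q hq; exists q; assert (hc' := le_cond hq); split; [now apply le_refl|].
exists z, r; repeat split; [auto|below|apply (IH z r); tauto].
Qed.

Lemma fIn_pr p x z r : name x -> pr z r ∈ x -> le PP p r -> fIn F p z x.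
Proof.
intros hx hz hp; apply fInE; auto; [now apply le_cond in hp|exact (name_pr hx hz)|].
intros q hq; exists q; assert (hc := le_cond hq); split; [now apply le_refl|].
exists z, r; repeat split; [auto|below|].
apply fEq_refl; [tauto|exact (name_pr hx hz)].
Qed.

Lemma fSub_in p x y z r s : name x -> name y -> fSub F p x y -> pr z r ∈ x ->
  le PP s p -> le PP s r ->
  exists q w t, le PP q s /\ pr w t ∈ y /\ le PP q t /\ fEq F q z w.
Proof.
intros hx hy h hz hs hsr; assert (hc := le_cond hs).
destruct (proj1 (@fSubE p x y (proj2 hc) hx hy) h z r hz s hs hsr) as (q & hq & hi).
assert (hc' := le_cond hq).
destruct (proj1 (@fInE q z y (proj1 hc') (name_pr hx hz) hy) hi q) as (q' & hq' & w & t & H);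
  [now apply le_refl|].
exists q', w, t; split; [below|exact H].
Qed.

(** Induction on [x] alone suffices: an element of [x] or of [z] is traced through
    [y] to the other side, where an element of [x] is again one of the three
    names, in first or, up to symmetry, in last place. *)
Lemma fEq_trans p x y z : p ∈∈ cond PP -> name x -> name y -> name z ->
  fEq F p x y -> fEq F p y z -> fEq F p x z.
Proof.
intros hp hx hy hz; revert x hx p hp y hy z hz.
apply (@hereditarily_ind _ _ PP _ (fun x => forall p, p ∈∈ cond PP ->
  forall y, name y -> forall z, name z ->
  fEq F p x y -> fEq F p y z -> fEq F p x z)).
{ apply Cls1_intro; define. }
intros x hx IH p hp y hy z hz; change (name x) in hx; rewrite !fEqE by auto.
intros [h1 h2] [h3 h4]; split; apply fSubE; auto.
- intros w r hw s hs hsr.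
  destruct (fSub_in hx hy h1 hw hs hsr) as (q & v & t & hq & hv & hqt & e1).
  destruct (@fSub_in p y z v t q) as (q' & u & t' & hq' & hu & hqt' & e2); auto.
  { below. }
  assert (hc := le_cond hq').
  exists q'; split; [below|].
  apply fInE; [tauto|exact (name_pr hx hw)|auto|].
  intros q2 hq2; exists q2; assert (hc2 := le_cond hq2); split; [now apply le_refl|].
  exists u, t'; repeat split; [auto|below|].
  assert (name w) by eauto using name_pr.
assert (name v) by eauto using name_pr.
assert (name u) by eauto using name_pr.
  apply (IH w r hw q2) with (y := v); auto; try tauto.
  + apply fEq_mono with (p := q); auto; below.
  + apply fEq_mono with (p := q'); auto; below.
- intros u r hu s hs hsr.
  destruct (fSub_in hz hy h4 hu hs hsr) as (q & v & t & hq & hv & hqt & e1).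
  destruct (@fSub_in p y x v t q) as (q' & w & t' & hq' & hw & hqt' & e2); auto.
  { below. }
  assert (hc := le_cond hq').
  exists q'; split; [below|].
  apply fInE; [tauto|exact (name_pr hz hu)|auto|].
  intros q2 hq2; exists q2; assert (hc2 := le_cond hq2); split; [now apply le_refl|].
  exists w, t'; repeat split; [auto|below|].
  assert (name w) by eauto using name_pr.
assert (name v) by eauto using name_pr.
assert (name u) by eauto using name_pr.
  apply fEq_sym; [tauto|auto|auto|].
  apply (IH w t' hw q2) with (y := v); auto; try tauto; apply fEq_sym; try tauto.
  + apply fEq_mono with (p := q'); auto; below.
  + apply fEq_mono with (p := q); auto; below.
Qed.

Lemma fIn_congr_l p x x' y : p ∈∈ cond PP -> name x -> name x' -> name y ->
  fEq F p x x' -> fIn F p x y -> fIn F p x' y.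
Proof.
intros hp hx hx' hy e; rewrite !fInE by auto; intros h s hs.
destruct (h s hs) as (q & hq & z & r & hz & hqr & h'); assert (hc := le_cond hq).
exists q; split; [exact hq|exists z, r; repeat split; auto].
assert (name z) by eauto using name_pr.
apply fEq_trans with (y := x); try tauto.
apply fEq_sym; try tauto; apply fEq_mono with (p := p); auto; below.
Qed.

Lemma fIn_sub p x y y' : p ∈∈ cond PP -> name x -> name y -> name y' ->
  fSub F p y y' -> fIn F p x y -> fIn F p x y'.
Proof.
intros hp hx hy hy' e h; apply (regular_fIn hx hy'); auto.
intros s hs; rewrite fInE in h by auto.
destruct (h s hs) as (q & hq & z & r & hz & hqr & h'); assert (hc := le_cond hq).
destruct (fSub_in hy hy' e hz (le_trans hq hs) hqr) as (q' & w & t & hq' & hw & hqt & e').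
assert (hc' := le_cond hq'); exists q'; split; [below|].
assert (name z) by eauto using name_pr.
assert (name w) by eauto using name_pr.
assert (fIn F q' w y') by eauto using fIn_pr.
apply fIn_congr_l with (x := z); try tauto.
- apply fEq_sym; try tauto; apply fEq_mono with (p := q); auto; below.
- apply fIn_congr_l with (x := w); try tauto; apply fEq_sym; tauto.
Qed.

Lemma fIn_congr_r p x y y' : p ∈∈ cond PP -> name x -> name y -> name y' ->
  fEq F p y y' -> fIn F p x y -> fIn F p x y'.
Proof.
intros hp hx hy hy' e; apply fIn_sub; auto; apply fEqE in e; tauto.
Qed.

Lemma fSub_mono p q x y : name x -> name y -> le PP q p -> fSub F p x y -> fSub F q x y.
Proof. intros hx hy; apply (regular_fSub hx hy). Qed.

(** ** Symmetry *)

(** Symmetry lemma.  A condition below π(p) is pulled back along π, the witnesses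
    found below [p] are pushed forward.  As in [fEq_trans], both inclusions
    reduce to equalities that involve an element of [x]. *)
Lemma act_fEq X p p' x x' y y' : automorphism PP X -> pr p p' ∈∈ X ->
  name x -> name y -> act X x x' -> act X y y' -> fEq F p x y -> fEq F p' x' y'.
Proof.
intros hX hp hx hy hxx hyy; revert x hx p p' hp x' hxx y hy y' hyy.
apply (@hereditarily_ind _ _ PP _ (fun x => forall p p', pr p p' ∈∈ X ->
  forall x', act X x x' -> forall y, name y -> forall y', act X y y' ->
  fEq F p x y -> fEq F p' x' y')).
{ apply Cls1_intro; define. }
intros x hx IH p p' hp x' hxx y hy y' hyy; change (name x) in hx.
assert (hx' := act_set_name hX hx hxx); assert (hy' := act_set_name hX hy hyy).
assert (hc := aut_cond hX hp); rewrite !fEqE by tauto.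
intros [h1 h2]; split; apply fSubE; auto; try tauto.
- intros z' r' hz' s' hs' hsr'.
  destruct (act_inv_pr hxx hz') as (z & r & z1 & r1 & hz & hzz & hr & [<- <-]%pr_inj).
  destruct (aut_onto hX (proj1 (le_cond hs'))) as [s hs].
  destruct (@fSub_in p x y z r s) as (q & w & t & hq & hw & hqt & e); auto.
  { now apply (aut_le hX hs hp). }
  { now apply (aut_le hX hs hr). }
  destruct (aut_total hX (proj1 (le_cond hq))) as [q' hq'].
  destruct (aut_total hX (proj2 (le_cond hqt))) as [t' ht'].
  destruct (proj2 (act_elim hyy) w t hw) as [w' hww].
  exists q'; split; [now apply (aut_le hX hq' hs)|].
  assert (name z') by eauto using name_pr.
  assert (fIn F q' w' y') by (eapply fIn_pr; eauto using act_pr;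
    now apply (aut_le hX hq' ht')).
  assert (hc' := aut_cond hX hq').
  assert (name w) by eauto using name_pr.
  assert (name w') by eauto using act_set_name.
  apply fIn_congr_l with (x := w'); auto; try tauto.
  apply fEq_sym; auto; try tauto; eauto.
- intros w' t' hw' s' hs' hst'.
  destruct (act_inv_pr hyy hw') as (w & t & w1 & t1 & hw & hww & ht & [<- <-]%pr_inj).
  destruct (aut_onto hX (proj1 (le_cond hs'))) as [s hs].
  destruct (@fSub_in p y x w t s) as (q & z & r & hq & hz & hqr & e); auto.
  { now apply (aut_le hX hs hp). }
  { now apply (aut_le hX hs ht). }
  destruct (aut_total hX (proj1 (le_cond hq))) as [q' hq'].
  destruct (aut_total hX (proj2 (le_cond hqr))) as [r' hr'].
  destruct (proj2 (act_elim hxx) z r hz) as [z' hzz].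
  exists q'; split; [now apply (aut_le hX hq' hs)|].
  assert (name w') by eauto using name_pr.
  assert (fIn F q' z' x') by (eapply fIn_pr; eauto using act_pr;
    now apply (aut_le hX hq' hr')).
  assert (hc' := aut_cond hX hq').
  assert (name z) by eauto using name_pr.
  assert (name w) by eauto using name_pr.
  assert (name z') by eauto using act_set_name.
  apply fIn_congr_l with (x := z'); auto; try tauto.
  apply (IH z r hz q q' hq' z' hzz w); auto; apply fEq_sym; auto; tauto.
Qed.

Lemma act_fIn X p p' x x' y y' : automorphism PP X -> pr p p' ∈∈ X ->
  name x -> name y -> act X x x' -> act X y y' -> fIn F p x y -> fIn F p' x' y'.
Proof.
intros hX hp hx hy hxx hyy; assert (hc := aut_cond hX hp).
assert (hx' := act_set_name hX hx hxx); assert (hy' := act_set_name hX hy hyy).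
rewrite !fInE by tauto; intros h s' hs'.
destruct (aut_onto hX (proj1 (le_cond hs'))) as [s hs].
destruct (h s) as (q & hq & z & r & hz & hqr & e); [now apply (aut_le hX hs hp)|].
destruct (aut_total hX (proj1 (le_cond hq))) as [q' hq'].
destruct (aut_total hX (proj2 (le_cond hqr))) as [r' hr'].
destruct (proj2 (act_elim hyy) z r hz) as [z' hzz].
exists q'; split; [now apply (aut_le hX hq' hs)|exists z', r'; repeat split].
- eapply act_pr; eauto.
- now apply (aut_le hX hq' hr').
- eapply act_fEq with (x := x) (y := z); eauto using name_pr.
Qed.

Lemma act_fSub X p p' x x' y y' : automorphism PP X -> pr p p' ∈∈ X ->
  name x -> name y -> act X x x' -> act X y y' -> fSub F p x y -> fSub F p' x' y'.
Proof.
intros hX hp hx hy hxx hyy; assert (hc := aut_cond hX hp).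
assert (hx' := act_set_name hX hx hxx); assert (hy' := act_set_name hX hy hyy).
rewrite !fSubE by tauto; intros h z' r' hz' s' hs' hsr'.
destruct (act_inv_pr hxx hz') as (z & r & z1 & r1 & hz & hzz & hr & [<- <-]%pr_inj).
destruct (aut_onto hX (proj1 (le_cond hs'))) as [s hs].
destruct (h z r hz s) as (q & hq & hi);
  [now apply (aut_le hX hs hp)|now apply (aut_le hX hs hr)|].
destruct (aut_total hX (proj1 (le_cond hq))) as [q' hq'].
exists q'; split; [now apply (aut_le hX hq' hs)|].
eapply act_fIn with (x := z) (y := y); eauto using name_pr.
Qed.

(** ** Class names *)

Lemma fInCE p x A : fInC PP F p x A <->
  dense_below PP (fun q => exists z r, pr z r ∈∈ A /\ le PP q r /\ fEq F q x z) p.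
Proof.
unfold fInC, dense_below; split; intros h q hq;
  destruct (h q hq) as (r & hr & z & t & hz & H); exists r;
  (split; [exact hr|exists z, t]); rewrite pair_inE in *; auto.
Qed.

Lemma regular_fInC x A : regular (fun p => fInC PP F p x A).
Proof.
eapply regular_ext; [|apply regular_dense_below].
intros p hp; symmetry; apply fInCE.
Qed.

Lemma class_name_pr A z p : class_name PP A -> pr z p ∈∈ A -> name z.
Proof.
intros h hz; destruct (h _ hz) as (z' & p' & e%is_pairE & hn & _).
now apply pr_inj in e as [-> _].
Qed.

Lemma fInC_congr p x x' A : p ∈∈ cond PP -> name x -> name x' -> class_name PP A ->
  fEq F p x x' -> fInC PP F p x A -> fInC PP F p x' A.
Proof.
intros hp hx hx' hA e; rewrite !fInCE; intros h s hs.
destruct (h s hs) as (q & hq & z & r & hz & hqr & h'); assert (hc := le_cond hq).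
exists q; split; [exact hq|exists z, r; repeat split; auto].
assert (name z) by eauto using class_name_pr.
apply fEq_trans with (y := x); try tauto.
apply fEq_sym; try tauto; apply fEq_mono with (p := p); auto; below.
Qed.

Lemma act_fInC X p p' x x' A : automorphism PP X -> pr p p' ∈∈ X ->
  name x -> class_name PP A -> act X x x' -> cact X A A ->
  fInC PP F p x A -> fInC PP F p' x' A.
Proof.
intros hX hp hx hA hxx hAA; rewrite !fInCE; intros h s' hs'.
destruct (aut_onto hX (proj1 (le_cond hs'))) as [s hs].
destruct (h s) as (q & hq & z & r & hz & hqr & e); [now apply (aut_le hX hs hp)|].
destruct (aut_total hX (proj1 (le_cond hq))) as [q' hq'].
destruct (aut_total hX (proj2 (le_cond hqr))) as [r' hr'].
assert (hnz : name z) by eauto using class_name_pr.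
destruct (act_total hX hnz) as [z' hzz].
exists q'; split; [now apply (aut_le hX hq' hs)|exists z', r'; repeat split].
- apply (hAA (pr z' r')); exists z, r, z', r'; rewrite !pair_inE.
  repeat split; auto; apply pr_spec.
- now apply (aut_le hX hq' hr').
- eapply act_fEq with (x := x) (y := z); eauto.
Qed.

(** ** Formulas *)

Context {N : vset M -> Prop}.
Hypothesis hN : forall x, N x -> name x.
Hypothesis hN1 : Cls1 N.

(** The forcing relation is meaningful only where the free variables are assigned
    names, while the assignment used for closed formulas takes a dummy value;
    [G] contains the variables that may occur free. *)
Fixpoint scoped (G : nat -> Prop) (phi : fml) : Prop :=
  match phi with
  | FIn i j | FEq i j => G i /\ G j
  | FInC i J => G i
  | FEqC J L => True
  | FAnd phi psi => scoped G phi /\ scoped G psi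
  | FNot phi => scoped G phi
  | FEx n phi => scoped (fun k => k = n \/ G k) phi
  end.

Lemma forces_regular phi (G : nat -> Prop) (e : nat -> vset M) (t : nat -> vcls M) :
  scoped G phi -> (forall i, G i -> N (e i)) -> regular (forces PP N F phi e t).
Proof.
revert G e; induction phi; intros G s0 hG hs; cbn in *.
- apply regular_fIn; apply hN, hs; tauto.
- apply regular_fEq; apply hN, hs; tauto.
- apply regular_fInC.
- apply regular_not; intros p q hq h r hr; apply h; below.
- apply regular_and; [eapply IHphi1|eapply IHphi2]; eauto; tauto.
- apply regular_not; eapply IHphi; eauto.
- split; [intros p q hq h r hr; apply h; below|].
  intros p hp h q hq; destruct (h q hq) as (r & hr & H).
  destruct (H r) as (r' & hr' & H'); [apply le_refl; now apply le_cond in hr|].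
  exists r'; split; [below|exact H'].
Qed.

Lemma forces_congr phi (G : nat -> Prop) (e e' : nat -> vset M) (t : nat -> vcls M) p :
  (forall J, class_name PP (t J)) -> scoped G phi -> p ∈∈ cond PP ->
  (forall i, G i -> N (e i) /\ N (e' i) /\ fEq F p (e i) (e' i)) ->
  forces PP N F phi e t p -> forces PP N F phi e' t p.
Proof.
intros ht; revert G e e' p; induction phi; intros G e1 e2 p hG hp hs; cbn in *.
- destruct (hs i) as (h1 & h2 & e), (hs j) as (h3 & h4 & e'); try tauto.
  intros h; apply fIn_congr_r with (y := e1 j); auto.
  apply fIn_congr_l with (x := e1 i); auto.
- destruct (hs i) as (h1 & h2 & e), (hs j) as (h3 & h4 & e'); try tauto.
  intros h; apply fEq_trans with (y := e1 j); auto.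
  apply fEq_trans with (y := e1 i); auto; apply fEq_sym; auto.
- destruct (hs i) as (h1 & h2 & e); [tauto|].
  apply fInC_congr; auto.
- auto.
- intros [h1 h2]; split; [eapply IHphi1|eapply IHphi2]; eauto; tauto.
- intros h q hq hn; apply (h q hq); assert (hc := le_cond hq).
  apply (IHphi G e2 e1 q); auto; try tauto; intros i hi.
  destruct (hs i hi) as (h1 & h2 & e); repeat split; auto.
  apply fEq_sym; auto; try tauto; apply fEq_mono with (p := p); auto.
- intros h q hq; destruct (h q hq) as (r & hr & z & hz & H).
  assert (hc := le_cond hr); exists r; split; [exact hr|exists z; split; [exact hz|]].
  revert H; apply (IHphi _ (upd e1 n z) (upd e2 n z) r hG (proj1 hc)).
  intros i hi; destruct (Nat.eq_dec i n) as [->|hne].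
  + rewrite !upd_eq; repeat split; auto; apply fEq_refl; auto; tauto.
  + rewrite !upd_neq by auto; destruct (hs i) as (h1 & h2 & e); [tauto|].
    repeat split; auto; apply fEq_mono with (p := p); auto; below.
Qed.

(** Definability of a relation between an assignment and a condition.  Variable 0
    holds the condition, variable 1 keeps a copy of it while a quantifier over
    stronger conditions reuses variable 0, and the assignment is shifted by 2. *)
Definition definable_forcing (R : (nat -> vset M) -> vset M -> Prop) :=
  definable 0 (fun s => R (fun i => s (S (S i))) (s 0)).

Lemma definable_forcing_below R :
  definable_forcing R -> definable_forcing (fun e p => forall q, le PP q p -> R e q).
Proof.
intros h; unfold definable_forcing; apply definable_iff with (P := fun s =>
  exists y, upd s 1 y 1 = upd s 1 y 0 /\ ~ exists q,
    le PP (upd (upd s 1 y) 0 q 0) (upd (upd s 1 y) 0 q 1) /\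
    ~ R (fun i => upd (upd s 1 y) 0 q (S (S i))) (upd (upd s 1 y) 0 q 0)).
- intros s; cbn; split.
  + intros (y & -> & hn) q hq; apply NNPP; intros hR; apply hn; now exists q.
  + intros H; exists (s 0); split; [reflexivity|]; intros (q & hq & hR); auto.
- apply (definable_upd 1 (P := fun s => s 1 = s 0 /\ ~ exists q,
    le PP (upd s 0 q 0) (upd s 0 q 1) /\
    ~ R (fun i => upd s 0 q (S (S i))) (upd s 0 q 0))).
  apply definable_and; [apply definable_var_eq|apply definable_not].
  apply (definable_upd 0 (P := fun s => le PP (s 0) (s 1) /\
    ~ R (fun i => s (S (S i))) (s 0))).
  apply definable_and; [|now apply definable_not].
  apply (@definable_level _ 2); define.
Qed.

Lemma definable_forcing_some R :
  definable_forcing R -> definable_forcing (fun e p => exists q, le PP q p /\ R e q).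
Proof.
intros h; assert (h' : definable_forcing (fun e p => ~ R e p)) by (now apply definable_not).
apply definable_forcing_below, (definable_not (k := 0)) in h'; revert h'; apply definable_iff.
intros s; cbn; split; [|intros (q & hq & h1) h2; exact (h2 q hq h1)].
intros H; apply NNPP; intros hn; apply H; intros q hq hR; apply hn; now exists q.
Qed.

Lemma Cls2_fInC A : Cls2 (fun p x => fInC PP F p x A).
Proof. apply Cls2_intro; unfold fInC; define. Qed.
#[local] Hint Resolve Cls2_fInC : cls.

Lemma definable_forces phi (t : nat -> vcls M) :
  definable_forcing (fun e => forces PP N F phi e t).
Proof.
induction phi; cbn.
- apply (@definable_cls3 _ _ (S (S (S (i + j)))) _ (fun s => s 0) (fun s => s (S (S i)))
    (fun s => s (S (S j)))); [apply Cls3_fIn|apply term_var; lia..].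
- apply (@definable_cls3 _ _ (S (S (S (i + j)))) _ (fun s => s 0) (fun s => s (S (S i)))
    (fun s => s (S (S j)))); [apply Cls3_fEq|apply term_var; lia..].
- apply (@definable_cls2 _ _ (S (S (S i))) (fun p x => fInC PP F p x (t J))
    (fun s => s 0) (fun s => s (S (S i))));
    [apply Cls2_fInC|apply term_var; lia..].
- apply (@definable_level _ 1); unfold fAll, fIff, fImp, fEx, fAnd, fNot; define.
- now apply definable_and.
- now apply definable_forcing_below, definable_not.
- apply definable_forcing_below, definable_forcing_some.
  apply definable_iff with (P := fun s => exists z, N (upd s (S (S n)) z (S (S n))) /\
    forces PP N F phi (fun i => upd s (S (S n)) z (S (S i))) t (upd s (S (S n)) z 0)).
  { intros s; split; intros [z hz]; exists z; rewrite upd_eq in *; exact hz. }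
  apply (definable_upd (S (S n)) (P := fun s => N (s (S (S n))) /\
    forces PP N F phi (fun i => s (S (S i))) t (s 0))).
  apply definable_and; [|exact IHphi].
  apply (@definable_cls1 _ (S (S (S n))) N (fun s => s (S (S n)))); auto.
  apply term_var; lia.
Qed.

(** The definability theorem, for formulas with two distinguished variables.
    Variable 1, free in [definable_forces], receives the coded triple. *)
Lemma Cls3_forces phi (e : nat -> vset M) (t : nat -> vcls M) i j : i <> j ->
  Cls3 (fun p u v => forces PP N F phi (upd (upd e i u) j v) t p).
Proof.
intros hij; set (e0 := fun k => match k with S (S k) => e k | _ => e 0 end).
assert (H : definable 0 (fun s => exists p u v : vset M,
  let s' := upd (upd (upd s 0 p) (S (S i)) u) (S (S j)) v in
  s' 1 = pr (s' 0) (pr (s' (S (S i))) (s' (S (S j)))) /\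
  forces PP N F phi (fun k => s' (S (S k))) t (s' 0))).
{ cbv zeta.
  apply (definable_upd 0 (P := fun s => exists u v : vset M,
    let s' := upd (upd s (S (S i)) u) (S (S j)) v in
    s' 1 = pr (s' 0) (pr (s' (S (S i))) (s' (S (S j)))) /\
    forces PP N F phi (fun k => s' (S (S k))) t (s' 0))); cbv zeta.
  apply (definable_upd (S (S i)) (P := fun s => exists v : vset M,
    let s' := upd s (S (S j)) v in
    s' 1 = pr (s' 0) (pr (s' (S (S i))) (s' (S (S j)))) /\
    forces PP N F phi (fun k => s' (S (S k))) t (s' 0))); cbv zeta.
  apply (definable_upd (S (S j)) (P := fun s =>
    s 1 = pr (s 0) (pr (s (S (S i))) (s (S (S j)))) /\
    forces PP N F phi (fun k => s (S (S k))) t (s 0))).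
  apply definable_and; [|apply definable_forces].
  apply (definable_level (k := S (S (S (i + j))))).
  apply (@definable_cls2 _ _ (S (S (S (i + j)))) _ (fun s => s 1)
    (fun s => pr (s 0) (pr (s (S (S i))) (s (S (S j)))))); [apply Cls2_eq|apply term_var; lia|].
  repeat apply term_pr; apply term_var; lia. }
destruct (comprehension e0 1 H) as [A hA]; exists A; intros p u v; rewrite hA.
assert (E : forall p1 u1 v1, let s' := upd (upd (upd (upd e0 1 (pr p (pr u v))) 0 p1)
    (S (S i)) u1) (S (S j)) v1 in
  (s' 1 = pr (s' 0) (pr (s' (S (S i))) (s' (S (S j)))) /\
   forces PP N F phi (fun k => s' (S (S k))) t (s' 0)) <->
  (pr p (pr u v) = pr p1 (pr u1 v1) /\
   forces PP N F phi (upd (upd e i u1) j v1) t p1)).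
{ intros p1 u1 v1 s'.
  assert (s' (S (S i)) = u1) as -> by (unfold s'; rewrite upd_neq by lia; apply upd_eq).
  assert (s' (S (S j)) = v1) as -> by apply upd_eq.
  reflexivity. }
split.
- intros (p1 & u1 & v1 & H1); apply E in H1 as [e1 H1].
  now apply pr_inj in e1 as [-> e1]; apply pr_inj in e1 as [-> ->].
- intros h; exists p, u, v; now apply E.
Qed.

End Forcing.
#[export] Hint Resolve Cls3_fEq Cls3_fIn Cls3_fSub Cls2_fInC : cls.

(** * Symmetric names *)

Existing Class class_symmetric_system.

Section SymmetricNames.
Context {M : structure} {hGB : GB M}.
Context {S : system M} {hS : class_symmetric_system S}.
Implicit Types (a b c d p q u v w x y z : vset M) (X Y Z : vcls M).
#[local] Notation PP := (forc S).

#[local] Instance forc_class_forcing : class_forcing PP := ss_forcing hS.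

Lemma is_piE d X : is_pi S d X -> forall p q, pr p q ∈∈ X <-> pr d (pr p q) ∈∈ cG S.
Proof.
intros h p q; rewrite (h (pr p q)); split.
- intros (p' & q' & e%is_pairE & H); apply pr_inj in e as [-> ->].
  now apply triple_inE in H.
- intros H; exists p, q; split; [apply pr_spec|now apply triple_inE].
Qed.

Lemma is_pi_exists d : exists X, is_pi S d X.
Proof.
destruct (@Cls1_intro _ _ (fun z => exists p q, is_pair z p q /\
  triple_in d p q (celts (cG S)))) as [X hX]; [define|now exists X].
Qed.

Lemma is_pi_unique d X X' : is_pi S d X -> is_pi S d X' -> X = X'.
Proof. intros h h'; apply (gb_cls_ext hGB); intros z; now rewrite (h z), (h' z). Qed.

(** The action as a relation of the index [d] too, which is what collection and
    comprehension over the group require. *)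
Definition acts d x y := exists X, is_pi S d X /\ act X x y.

Lemma name_map_iff (A A' : vset M -> vset M -> Prop) f :
  (forall p p', A p p' <-> A' p p') -> name_map A f -> name_map A' f.
Proof.
intros h hf u v huv; destruct (hf u v huv) as [h1 h2]; split; [|exact h2].
intros w; rewrite (h1 w); split; intros (z & p & z' & p' & hz & hzz & hp & e);
  exists z, p, z', p'; repeat split; auto; now apply h.
Qed.

Lemma Cls3_acts : Cls3 acts.
Proof.
destruct (@Cls3_intro _ _ (fun d x y => exists f, pr x y ∈ f /\
  name_map (fun p p' => pr d (pr p p') ∈∈ cG S) f)) as [A hA].
{ unfold name_map, moved; define. }
exists A; intros d x y; rewrite hA; split.
- intros (f & hf & h); destruct (is_pi_exists d) as [X hX].
  exists X; split; [exact hX|apply actE; exists f; split; [exact hf|]].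
  revert h; apply name_map_iff; intros p p'; symmetry; now apply is_piE.
- intros (X & hX & (f & hf & h)%actE); exists f; split; [exact hf|].
  revert h; apply name_map_iff; now apply is_piE.
Qed.
#[local] Hint Resolve Cls3_acts : cls.

Lemma actsE d X x y : is_pi S d X -> acts d x y <-> act X x y.
Proof.
intros h; split; [|now exists X].
intros (X' & h' & H); now rewrite (is_pi_unique h h').
Qed.

Lemma domGE d : domG S d <-> exists z, pr d z ∈∈ cG S.
Proof. unfold domG, dom; split; intros [z hz]; exists z; now apply pair_inE. Qed.

Lemma grp_aut X : grp S X -> automorphism PP X.
Proof. intros (d & hd & h); exact (ss_aut hS hd h). Qed.

Lemma baseE a X : base S a X <-> exists d, pr a d ∈∈ cF S /\ is_pi S d X.
Proof. unfold base; split; intros (d & h & H); exists d; now rewrite pair_inE in *. Qed.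

Lemma base_grp a X : domF S a -> base S a X -> grp S X.
Proof. intros ha; apply (ss_base hS ha). Qed.

Lemma base_aut a X : domF S a -> base S a X -> automorphism PP X.
Proof. intros ha hX; apply grp_aut; exact (base_grp ha hX). Qed.

Lemma base_id a X : domF S a -> is_id PP X -> base S a X.
Proof. intros ha; apply (ss_base hS ha). Qed.

Lemma base_comp a X Y Z : domF S a -> base S a X -> base S a Y -> is_comp Z X Y -> base S a Z.
Proof. intros ha; apply (ss_base hS ha). Qed.

Lemma base_inv a X Y : domF S a -> base S a X -> is_inv Y X -> base S a Y.
Proof. intros ha; apply (ss_base hS ha). Qed.

Lemma is_inv_sym a X Y : domF S a -> base S a X -> is_inv Y X -> is_inv X Y.
Proof.
intros ha hX hY z; split.
- intros hz; destruct (proj1 (base_aut ha hX) z hz) as (p & q & h & _).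
  exists p, q; split; [exact h|apply is_pairE in h as ->].
  now apply pair_inE, (is_invE hY).
- intros (p & q & h%is_pairE & H%pair_inE); subst z; now apply (is_invE hY) in H.
Qed.

(** The stabilizer of a name is a group, so it lies in the filter as soon as it
    contains a group from the base.  This condition is first-order, while
    [symmetric] quantifies over classes; hence [HS S] is a class. *)
Lemma symmetric_iff x : set_name PP x ->
  symmetric S x <-> exists a, domF S a /\ forall d, pr a d ∈∈ cF S -> acts d x x.
Proof.
intros hx; split.
- intros (_ & _ & a & ha & h); exists a; split; [exact ha|intros d hd].
  destruct (is_pi_exists d) as [X hX]; exists X; split; [exact hX|].
  apply h, baseE; now exists d.
- intros (a & ha & h).
  assert (h' : forall X, base S a X -> act X x x).
  { intros X (d & hd & hX)%baseE; apply (actsE x x hX); auto. }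
  split; [split; [now intros X [hX _]|]|split; [|exists a; split; [exact ha|]]].
  + destruct (ss_group hS) as (h1 & h2 & h3); repeat apply conj.
    * intros X hX; split; [auto|exact (act_id hX hx)].
    * intros X Y Z [hX hXx] [hY hYx] hZ; split; [eauto|].
      apply (act_comp (grp_aut hY) hZ hx hYx hXx).
    * intros X Y [hX hXx] hY; split; [eauto|].
      exact (act_inv (grp_aut hX) hY hx hXx).
  + destruct (@Cls1_intro _ _ (fun d => acts d x x /\ exists z, pr d z ∈∈ cG S))
      as [C hC]; [define|exists C; split].
    * intros d hd; apply domGE; now apply hC.
    * intros X; split.
      -- intros [(d & hd & hX) hXx]; exists d; split; [|exact hX].
         apply hC; split; [now exists X|now apply domGE].
      -- intros (d & [hdx hd]%hC & hX); split; [exists d; split; [now apply domGE|auto]|].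
         now apply (actsE x x hX).
  + intros X hX; split; [exact (base_grp ha hX)|auto].
Qed.

Lemma Cls1_domF : Cls1 (domF S).
Proof. apply Cls1_intro; unfold domF, dom; define. Qed.
#[local] Hint Resolve Cls1_domF : cls.

Lemma hereditarily_iff (Q Q' : vset M -> Prop) x :
  (forall y, set_name PP y -> (Q y <-> Q' y)) ->
  hereditarily PP Q x <-> hereditarily PP Q' x.
Proof.
intros h; split; intros (t & hx & ht); exists t; (split; [exact hx|]);
  intros y hy; (split; [|apply (ht y hy)]); apply h; try apply (ht y hy);
  exists t; (split; [exact hy|]); intros u hu; split; auto; apply (ht u hu).
Qed.

Lemma HS_iff x : HS S x <-> hereditarily PP (fun y =>
  exists a, domF S a /\ forall d, pr a d ∈∈ cF S -> acts d y y) x.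
Proof. apply hereditarily_iff; intros y hy; now apply symmetric_iff. Qed.

Lemma Cls1_HS : Cls1 (HS S).
Proof.
destruct (@Cls1_hereditarily _ _ PP (fun y => exists a, domF S a /\
  forall d, pr a d ∈∈ cF S -> acts d y y)) as [A hA]; [apply Cls1_intro; define|].
exists A; intros x; now rewrite hA, HS_iff.
Qed.
#[local] Hint Resolve Cls1_HS : cls.

Lemma HS_set_name x : HS S x -> set_name PP x.
Proof. now apply hereditarily_weaken. Qed.

Lemma HS_pr x z p : HS S x -> pr z p ∈ x -> HS S z /\ p ∈∈ cond PP.
Proof. apply hereditarily_pr. Qed.

Lemma HS_fixed x : HS S x -> exists a, domF S a /\ forall X, base S a X -> act X x x.
Proof.
intros [(a & ha & h) _]%HS_iff%hereditarily_elim; exists a; split; [exact ha|].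
intros X (d & hd & hX)%baseE; apply (actsE x x hX); auto.
Qed.

Lemma HS_intro x a : domF S a -> (forall X, base S a X -> act X x x) ->
  (forall u, u ∈ x -> exists z p, u = pr z p /\ HS S z /\ p ∈∈ cond PP) -> HS S x.
Proof.
intros ha h hx; apply HS_iff, hereditarily_intro.
- apply Cls1_intro; define.
- exists a; split; [exact ha|intros d hd]; destruct (is_pi_exists d) as [X hX].
  exists X; split; [exact hX|apply h, baseE; now exists d].
- intros u hu; destruct (hx u hu) as (z & p & e & hz%HS_iff & hp); now exists z, p.
Qed.

(** The inclusion of [x] in its image follows from the inclusion of the image in
    [x] under the inverse automorphism, which is also in [base S a]. *)
Lemma fixed_of_forward x a : set_name PP x -> domF S a ->
  (forall X z p z' p', base S a X -> pr z p ∈ x -> act X z z' -> pr p p' ∈∈ X ->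
     pr z' p' ∈ x) ->
  forall X, base S a X -> act X x x.
Proof.
intros hx ha h X hX; assert (hA := base_aut ha hX); apply act_intro.
- intros z p hz; apply (act_total hA), (name_pr hx hz).
- intros w; split; [intros hw|intros (z & p & z' & p' & hz & hzz & hp & ->); eauto].
  destruct (proj2 (hereditarily_elim hx) w hw) as (z & p & -> & hz & hp).
  destruct (is_inv_exists X) as [Y hY].
  assert (hYb := base_inv ha hX hY); assert (hYA := base_aut ha hYb).
  destruct (act_total hYA hz) as [z0 hz0], (aut_total hYA hp) as [p0 hp0].
  exists z0, p0, z, p; repeat split; eauto.
  + exact (act_inv hYA (is_inv_sym ha hX hY) hz hz0).
  + now apply (is_invE hY).
Qed.

(** If [H_a] fixes [x] then its conjugate by [X] fixes the image of [x], and by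
    normality that conjugate contains a group from the base. *)
Lemma HS_act X x x' : grp S X -> HS S x -> act X x x' -> HS S x'.
Proof.
intros hX hx; assert (hA := grp_aut hX); revert x hx x'.
apply (@hereditarily_ind _ _ PP _ (fun x => forall x', act X x x' -> HS S x')).
{ apply Cls1_intro; define. }
intros x hx IH x' hxx; change (HS S x) in hx.
assert (hnx := HS_set_name hx).
destruct (HS_fixed hx) as (a & ha & hfix), hX as (d & hd & hXd).
destruct (ss_normal hS ha hd) as (c & hc & hconj).
apply (HS_intro (a := c)); [exact hc| |].
- intros Z hZ; destruct (hconj Z hZ) as (D & Y & hD & hY & D' & W & hD' & hW & hZ').
  assert (D = X) as -> by exact (is_pi_unique hD hXd).
  destruct (ss_group hS) as (_ & hcomp & hinv).
  assert (grp S X) by now exists d.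
  assert (grp S D') by now apply (hinv X D').
  assert (grp S W) by (apply (hcomp Y D' W); eauto using base_grp).
  assert (hnx' := act_set_name hA hnx hxx).
  apply (act_comp (PP := PP) (Y := W) (X := X) (y := x)); auto using grp_aut.
  apply (act_comp (PP := PP) (Y := D') (X := Y) (y := x)); auto using grp_aut.
  exact (act_inv hA hD' hnx hxx).
- intros w hw; destruct (act_inv_pr hxx hw) as (z & p & z' & p' & hz & hzz & hp & ->).
  exists z', p'; repeat split; [eauto|now apply (aut_cond hA) in hp].
Qed.

(** ** Symmetric covers *)

Hypothesis hstrat : stratified S.

Lemma stratified_cover c : (forall p, p ∈ c -> p ∈∈ cond PP) ->
  exists b a, domF S a /\ (forall p, p ∈ c -> p ∈ b) /\
    (forall p, p ∈ b -> p ∈∈ cond PP) /\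
    forall X p p', base S a X -> p ∈ b -> pr p p' ∈∈ X -> p' ∈ b.
Proof.
intros hc; destruct (hstrat hc) as (b & hb & (_ & _ & a & ha & h) & hcb).
exists b, a; repeat split; auto; intros X p p' hX hp hpp.
apply (proj2 (h X hX)); exists p; split; [exact hp|now apply pair_inE].
Qed.

(** A set of names has a set as orbit because of the set [b] of conditions: the
    action of an automorphism on names with conditions in [b] depends on its
    restriction to [b] only, and the possible restrictions are subsets of b × b. *)
Lemma orbit_set B b a : domF S a ->
  (forall v, v ∈ B -> exists t, v ∈ t /\ forall y, y ∈ t ->
     set_name PP y /\ forall z p, pr z p ∈ y -> z ∈ t /\ p ∈ b) ->
  (forall X p p', base S a X -> p ∈ b -> pr p p' ∈∈ X -> p' ∈ b) ->
  exists O, forall w, w ∈ O <-> exists X v, base S a X /\ v ∈ B /\ act X v w.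
Proof.
intros ha hB hb.
destruct (product b b) as [b2 hb2], (gb_powerset hGB b2) as [G hG].
set (restr d g := forall w, w ∈ g <->
  exists p p', w = pr p p' /\ p ∈ b /\ pr d (pr p p') ∈∈ cG S).
destruct (@collection _ _ G (fun g d => pr a d ∈∈ cF S /\ restr d g)) as (D & hD & hD').
{ apply Cls2_intro; unfold restr; define. }
assert (hDcF : forall d, d ∈ D -> pr a d ∈∈ cF S)
  by (intros d hd; now apply hD' in hd as (? & _ & ? & _)).
destruct (product D B) as [DB hDB].
destruct (@replacement _ _ DB (fun u w => exists d v, u = pr d v /\ acts d v w)) as [O hO].
{ apply Cls2_intro; define. }
{ intros u w w' _ (d & v & -> & X & hX & h) (d' & v' & [<- <-]%pr_inj & X' & hX' & h').
  rewrite (is_pi_unique hX' hX) in h'; exact (act_fun h h'). }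
exists O; intros w; rewrite hO; split.
- intros (u & (d & v & hd & hv & ->)%hDB & d' & v' & [<- <-]%pr_inj & X & hX & h).
  exists X, v; repeat split; auto; apply baseE; exists d; split; auto.
- intros (X & v & hX & hv & h); assert (hA := base_aut ha hX).
  destruct (proj1 (baseE a X) hX) as (d & hd & hXd).
  destruct (@separation _ _ (fun w => exists p p', w = pr p p' /\ p ∈ b /\
    pr d (pr p p') ∈∈ cG S) b2) as [g hg]; [apply Cls1_intro; define|].
  assert (hg' : restr d g).
  { intros w1; rewrite hg; split; [tauto|intros (p & p' & -> & hp & H)].
    split; [|now exists p, p']; apply hb2; exists p, p'; repeat split; auto.
    apply (hb X p p'); auto; now apply (is_piE hXd). }
  destruct (hD g) as (d' & hd' & _ & hg'').
  { apply hG; intros w1 hw1; now apply hg in hw1. }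
  { now exists d. }
  destruct (is_pi_exists d') as [X' hX'].
  assert (hX'b : base S a X') by (apply baseE; exists d'; auto).
  destruct (hB v hv) as (t & hvt & ht).
  destruct (act_total (base_aut ha hX'b) (proj1 (ht v hvt))) as [w' hw'].
  assert (w = w') as <-.
  { apply (act_agree (t := t) (X := X) (X' := X') (x := v)); auto.
    intros u z p hu hz; destruct (ht u hu) as [_ h1], (h1 z p hz) as [hzt hp].
    split; [exact hzt|intros p'].
    rewrite (is_piE hXd), (is_piE hX').
    assert (E : pr p p' ∈ g <-> pr d (pr p p') ∈∈ cG S).
    { rewrite (hg' (pr p p')); split; [|intros; now exists p, p'].
      now intros (p1 & p1' & [<- <-]%pr_inj & _ & H). }
    rewrite <- E, (hg'' (pr p p')); split; [|intros; now exists p, p'].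
    now intros (p1 & p1' & [<- <-]%pr_inj & _ & H). }
  exists (pr d' v); split; [apply hDB; now exists d', v|].
  exists d', v; split; [reflexivity|now exists X'].
Qed.

(** Stratification lifts from conditions to names.  [B'] is the orbit of [B] under
    a group preserving a set [b] of conditions that contains all those occurring
    in the names of [B]. *)
Lemma symmetric_cover B C :
  (forall v, v ∈ B -> HS S v) -> (forall p, p ∈ C -> p ∈∈ cond PP) ->
  exists B' b a, domF S a /\
    (forall v, v ∈ B -> v ∈ B') /\ (forall v, v ∈ B' -> HS S v) /\
    (forall p, p ∈ C -> p ∈ b) /\ (forall p, p ∈ b -> p ∈∈ cond PP) /\
    (forall X p p', base S a X -> p ∈ b -> pr p p' ∈∈ X -> p' ∈ b) /\
    (forall X v v', base S a X -> v ∈ B' -> act X v v' -> v' ∈ B').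
Proof.
intros hB hC.
set (wit t := forall y, y ∈ t -> True /\ name_over PP (elts t) (elts y)).
assert (hwit : forall t y, wit t -> y ∈ t -> set_name PP y /\
  forall z p, pr z p ∈ y -> z ∈ t /\ p ∈∈ cond PP).
{ intros t y ht hy; split; [now exists t|intros z p hz].
  destruct (proj2 (ht y hy) _ hz) as (z' & p' & e%is_pairE & H).
  now apply pr_inj in e as [-> ->]. }
destruct (@collection _ _ B (fun v t => v ∈ t /\ wit t)) as (T & hT & hT').
{ apply Cls2_intro; unfold wit, name_over, elts; define. }
destruct (gb_union hGB T) as [T1 hT1], (gb_union hGB T1) as [T2 hT2].
destruct (range T2) as [C0 hC0], (union2 C0 C) as [C1 hC1].
destruct (@stratified_cover C1) as (b & a & ha & hb & hbP & hba).
{ intros p [[z (y & (t & ht & hy)%hT1 & hz)%hT2]%hC0|hp]%hC1; auto.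
  destruct (hT' t ht) as (_ & _ & _ & hw); now apply (hwit t y hw hy) in hz. }
destruct (@orbit_set B b a ha) as [B' hB']; auto.
{ intros v hv; destruct (hT v hv) as (t & ht & hvt & hw).
  { destruct (HS_set_name (hB v hv)) as (t & hvt & ht); now exists t. }
  exists t; split; [exact hvt|intros y hy]; destruct (hwit t y hw hy) as [hy1 hy2].
  split; [exact hy1|intros z p hz]; split; [now apply (hy2 z p)|].
  apply hb, hC1; left; apply hC0; exists z; apply hT2; exists y; split; [|exact hz].
  apply hT1; now exists t. }
exists B', b, a; repeat apply conj; auto.
- intros v hv; apply hB'; destruct (is_id_exists PP) as [X hX].
  exists X, v; repeat split; [now apply base_id|exact hv|].
  apply (act_id hX), HS_set_name; auto.
- intros w (X & v & hX & hv & h)%hB'; apply (HS_act (X := X) (x := v)); auto.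
  exact (base_grp ha hX).
- intros p hp; apply hb, hC1; auto.
- intros X w w' hX (Y & v & hY & hv & h)%hB' h'; apply hB'.
  destruct (is_comp_exists X Y) as [Z hZ]; exists Z, v; repeat split; auto.
  + exact (base_comp ha hX hY hZ).
  + apply (act_comp (base_aut ha hY) hZ (HS_set_name (hB v hv)) h h').
Qed.

End SymmetricNames.
#[export] Hint Resolve Cls1_HS : cls.

(** * Tameness of stratified systems *)

Section Pretame.
Context {M : structure} {hGB : GB M}.
Context {PP : forcing_triple M} {hPP : class_forcing PP}.
Implicit Types (p q r d i e : vset M).

(** Pretameness, applied to the dense classes of conditions deciding [K i], bounds
    by a set the conditions needed to witness [K i] below [q]: a condition that
    is compatible with one where [K i] holds cannot have decided against it. *)
Lemma pretame_decide (K : vset M -> vset M -> Prop) I p : pretame PP -> Cls2 K ->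
  (forall i r s, le PP s r -> K i r -> K i s) -> p ∈∈ cond PP ->
  exists q e, le PP q p /\ (forall i d, pr i d ∈ e -> d ∈∈ cond PP) /\
    forall i r, i ∈ I -> le PP r q -> K i r ->
      exists d s, pr i d ∈ e /\ K i d /\ le PP s r /\ le PP s d.
Proof.
intros hpre hK hmono hp.
destruct (@Cls1_intro _ _ (fun w => exists i d, w = pr i d /\ i ∈ I /\ d ∈∈ cond PP /\
  (K i d \/ forall q, le PP q d -> ~ K i q))) as [D hD].
{ define. }
assert (hDi : forall i d, section (celts D) i d <-> i ∈ I /\ d ∈∈ cond PP /\
  (K i d \/ forall q, le PP q d -> ~ K i q)).
{ intros i d; unfold section; rewrite pair_inE; unfold celts; rewrite hD; split.
  - now intros (i' & d' & [<- <-]%pr_inj & H).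
  - intros H; now exists i, d. }
destruct (hpre p I D hp) as (q & e & hq & he & H).
- intros w (i & d & -> & hi & _)%hD; exists i, d; split; [exact hi|apply pr_spec].
- intros i hi; split; [intros d hd; now apply hDi in hd|intros r hr].
  destruct (classic (exists s, le PP s r /\ K i s)) as [(s & hs & hKs)|hn].
  + exists s; split; [exact hs|apply hDi].
    repeat split; auto; now apply le_cond in hs.
  + exists r; split; [now apply le_refl|apply hDi]; repeat split; auto.
    right; intros s hs hKs; apply hn; now exists s.
- assert (heD : forall i d, pr i d ∈ e -> i ∈ I /\ section (celts D) i d).
  { intros i d hd; destruct (he _ hd) as (i' & d' & hi & ed%is_pairE).
    apply pr_inj in ed as [<- <-]; split; [exact hi|].
    apply (H i hi); now apply pair_inE. }
  exists q, e; repeat split; auto.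
  + intros i d [_ h]%heD; now apply hDi in h.
  + intros i r hi hr hKr; destruct (H i hi) as [_ hpd].
    destruct (hpd r hr) as (d & hd%pair_inE & s & hsr & hsd).
    exists d, s; repeat split; auto.
    destruct (heD i d hd) as [_ (_ & _ & [hKd|hn])%hDi]; [exact hKd|].
    destruct (hn s hsd); eauto.
Qed.

End Pretame.

Section Tame.
Context {M : structure} {hGB : GB M}.
Context {S : system M} {hS : class_symmetric_system S}.
Hypothesis (hstrat : stratified S) (hpre : pretame (forc S)).
#[local] Notation PP := (forc S).
#[local] Existing Instance forc_class_forcing.
Context {F : atomic M} (hF : atomic_forcing PP (set_name PP) F).
Implicit Types (a b c d e p q r u v w x y z : vset M).
#[local] Hint Resolve HS_set_name : core.

(** The clauses for [x] and [y] only refer to names inside [x] and [y], which are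
    in [HS S] if [x] and [y] are. *)
Lemma atomic_forcing_HS : atomic_forcing PP (HS S) F.
Proof. intros p x y hp hx hy; apply hF; auto. Qed.

(** The names exhibited below for existential statements all have the form
    { ⟨z,s⟩ | z ∈ I, s ∈ b, K z s }; they are symmetric because [I], [b] and
    [K] are invariant under a common group from the base. *)
Lemma HS_comprehension I b c (K : vset M -> vset M -> Prop) : domF S c -> Cls2 K ->
  (forall z, z ∈ I -> HS S z) -> (forall s, s ∈ b -> s ∈∈ cond PP) ->
  (forall X z s z' s', base S c X -> act X z z' -> pr s s' ∈∈ X ->
     z ∈ I -> s ∈ b -> K z s -> z' ∈ I /\ s' ∈ b /\ K z' s') ->
  exists y, HS S y /\ forall z s, pr z s ∈ y <-> z ∈ I /\ s ∈ b /\ K z s.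
Proof.
intros hc hK hI hb hfix; destruct (product I b) as [Ib hIb].
destruct (@separation _ _ (fun w => exists z s, w = pr z s /\ K z s) Ib) as [y hy].
{ apply Cls1_intro; define. }
assert (hy' : forall z s, pr z s ∈ y <-> z ∈ I /\ s ∈ b /\ K z s).
{ intros z s; rewrite hy, hIb; split.
  - intros [(z1 & s1 & h1 & h2 & [<- <-]%pr_inj) (z2 & s2 & [<- <-]%pr_inj & h3)]; auto.
  - intros (h1 & h2 & h3); split; now exists z, s. }
assert (hname : forall w, w ∈ y -> exists z p, w = pr z p /\ HS S z /\ p ∈∈ cond PP).
{ intros w hw; assert (hw' := hw); apply hy in hw' as [_ (z & s & -> & _)].
  apply hy' in hw as (h1 & h2 & _); exists z, s; auto. }
exists y; split; [|exact hy'].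
apply (HS_intro (a := c)); [exact hc| |exact hname].
apply fixed_of_forward; [|exact hc|].
- apply set_name_intro; intros w hw; destruct (hname w hw) as (z & p & e & hz & hp).
  exists z, p; auto.
- intros X z s z' s' hX (h1 & h2 & h3)%hy' hzz hss; apply hy'.
  now apply (hfix X z s z' s').
Qed.

Lemma act_domain X x d : act X x x -> (forall z, z ∈ d <-> exists p, pr z p ∈ x) ->
  automorphism PP X -> set_name PP x ->
  forall z z', act X z z' -> z ∈ d -> z' ∈ d.
Proof.
intros hx hd hX hn z z' hz [p hp]%hd.
destruct (aut_total hX (proj2 (hereditarily_pr hn hp))) as [p' hp'].
apply hd; exists p'; exact (act_pr hx hp hz hp').
Qed.

Lemma base_inter2 a b : domF S a -> domF S b -> exists c, domF S c /\
  forall X, base S c X -> base S a X /\ base S b X.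
Proof. apply (ss_inter hS). Qed.

(** A name for x ∩ Γ is formed by the pairs ⟨z,s⟩ with [z] inside [x] and [s]
    forcing z ∈ x and z ∈ Γ, where [s] ranges over a symmetric set that contains
    the conditions provided by [pretame_decide]. *)
Lemma separation_forced A : class_S_name S A -> one_forces PP (HS S) separation_fml A.
Proof.
intros [(_ & _ & a1 & ha1 & hfixA) hA]; exists F; split; [exact atomic_forcing_HS|].
assert (hcA : class_name PP A).
{ intros w hw; destruct (hA w hw) as (z & p & h1 & h2 & h3); exists z, p; auto. }
apply fAll_intro; intros x hx p hp; assert (hcp := le_cond hp).
destruct (domain x) as [I hI], (HS_fixed hx) as (a2 & ha2 & hfixx).
assert (hIHS : forall z, z ∈ I -> HS S z) by (intros z [s hs]%hI; exact (proj1 (HS_pr hx hs))).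
set (K z s := fIn F s z x /\ fInC PP F s z A).
assert (hK : Cls2 K) by (apply Cls2_intro; unfold K; define).
destruct (@pretame_decide _ _ PP _ (fun z s => z ∈ I /\ K z s) I p)
  as (q & e & hq & he & hdec); try tauto.
{ apply Cls2_intro; define. }
{ intros z r s hs (hz & h1 & h2); repeat split; auto.
  - apply (fIn_mono hF) with (p := r); auto.
  - exact (proj1 (regular_fInC z A) r s hs h2). }
destruct (range e) as [C hC], (stratified_cover hstrat (c := C)) as (b & a3 & ha3 & hCb & hb & hb3).
{ intros d [i hd]%hC; exact (he i d hd). }
destruct (base_inter2 ha1 ha2) as (a4 & ha4 & h4), (base_inter2 ha3 ha4) as (c & hc & hc').
destruct (@HS_comprehension I b c K) as (y & hy & hyE); auto.
{ intros X z s z' s' hX hzz hss hz hs [h1 h2]; destruct (hc' X hX) as [hX3 hX4].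
  destruct (h4 X hX4) as [hX1 hX2]; assert (hXA := base_aut hc hX).
  repeat split.
  - apply (act_domain (hfixx X hX2) hI hXA (HS_set_name hx) hzz hz).
  - exact (hb3 X s s' hX3 hs hss).
  - apply (act_fIn hF hXA hss (HS_set_name (hIHS z hz)) (HS_set_name hx) hzz); auto.
  - apply (act_fInC hF hXA hss (HS_set_name (hIHS z hz)) hcA hzz); auto.
    now apply hfixA. }
exists q; split; [exact hq|]; intros q1 hq1; assert (hcq := le_cond hq1).
exists q1; split; [apply le_refl; tauto|exists y; split; [exact hy|]].
apply fAll_intro; intros z hz r hr; assert (hcr := le_cond hr).
exists r; split; [apply le_refl; tauto|].
change (fIff PP (fun p => fIn F p z y)
  (fAnd (fun p => fIn F p z x) (fun p => fInC PP F p z A)) r).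
split; apply fImp_intro; intros r1 hr1 h; assert (hc1 := le_cond hr1).
- apply (fInE hF) in h; auto; try tauto.
  destruct (h r1) as (r2 & hr2 & z1 & s & (hz1 & hs & h1 & h2)%hyE & hrs & e1);
    [apply le_refl; tauto|assert (hc2 := le_cond hr2)].
  assert (hn1 := HS_set_name (hIHS z1 hz1)).
  assert (fEq F r2 z1 z) by (apply (fEq_sym hF); auto; tauto).
  exists r2; split; [exact hr2|split].
  + apply (fIn_congr_l hF) with (x := z1); auto; try tauto.
    apply (fIn_mono hF) with (p := s); auto.
  + apply (fInC_congr hF) with (x := z1); auto; try tauto.
    exact (proj1 (regular_fInC z1 A) s r2 hrs h2).
- destruct h as [h1 h2]; assert (h1' := h1); apply (fInE hF) in h1'; auto; try tauto.
  destruct (h1' r1) as (r2 & hr2 & z1 & s & hz1 & hrs & e1);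
    [apply le_refl; tauto|assert (hc2 := le_cond hr2)].
  assert (hz1I : z1 ∈ I) by (apply hI; now exists s).
  assert (hn1 := HS_set_name (hIHS z1 hz1I)).
  assert (hK1 : K z1 r2).
  { split.
    - apply (fIn_congr_l hF) with (x := z); auto; try tauto.
      apply (fIn_mono hF) with (p := r1); auto.
    - apply (fInC_congr hF) with (x := z); auto; try tauto.
      exact (proj1 (regular_fInC z A) r1 r2 hr2 h2). }
  destruct (hdec z1 r2 hz1I) as (d & r3 & hd & [_ hKd] & hr3 & hr3d); auto; [below|].
  assert (hc3 := le_cond hr3).
  exists r3; split; [below|apply (fIn_congr_l hF) with (x := z1); auto; try tauto].
  + apply (fEq_sym hF); auto; try tauto; apply (fEq_mono hF) with (p := r2); auto.
  + apply (fIn_pr hF) with (r := d); auto.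
    apply hyE; repeat split; try apply hKd; auto; apply hCb, hC; now exists z1.
Qed.

(** For each [u] inside [x], a set of conditions [d] suffices to force ⟨u,v⟩ ∈ Γ for
    some [v]; witnesses [v] for all these are collected into a set, and the name
    is made of a symmetric cover of that set. *)
Lemma collection_forced A : class_S_name S A -> one_forces PP (HS S) collection_fml A.
Proof.
intros [_ hA]; exists F; split; [exact atomic_forcing_HS|].
assert (hcA : class_name PP A).
{ intros w hw; destruct (hA w hw) as (z & p & h1 & h2 & h3); exists z, p; auto. }
set (e0 := fun _ : nat => one PP); set (t := fun _ : nat => A).
set (phi := FPairInC 1 2 0).
pose (Phi p u v := forces PP (HS S) F phi (upd (upd e0 1 u) 2 v) t p).
assert (hPhi : Cls3 Phi) by (apply Cls3_forces; [apply Cls1_HS|discriminate]).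
assert (hsc : scoped (fun i => i = 1 \/ i = 2) phi) by (cbn; tauto).
assert (hmono : forall p q u v, HS S u -> HS S v -> le PP q p -> Phi p u v -> Phi q u v).
{ intros p q u v hu hv; apply (forces_regular hF HS_set_name t hsc).
  now intros i [-> | ->]. }
assert (hcongr : forall p u u' v, p ∈∈ cond PP -> HS S u -> HS S u' -> HS S v ->
  fEq F p u u' -> Phi p u v -> Phi p u' v).
{ intros p u u' v hp hu hu' hv e1; apply (forces_congr hF HS_set_name) with
    (G := fun i => i = 1 \/ i = 2); auto.
  - intros i [-> | ->]; cbn; repeat split; auto; apply (fEq_refl hF); auto. }
apply fAll_intro; intros x hx p0 hp0; assert (hc0 := le_cond hp0).
exists p0; split; [apply le_refl; tauto|].
change (fImp PP (fAnd (forces PP (HS S) F (relation_fml 0) (upd e0 0 x) t)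
    (fAll PP (HS S) (fun u => fImp PP (fun p => fIn F p u x)
      (fEx PP (HS S) (fun v p => Phi p u v)))))
  (fEx PP (HS S) (fun y => fAll PP (HS S) (fun u => fImp PP (fun p => fIn F p u x)
    (fEx PP (HS S) (fun v => fAnd (fun p => fIn F p v y) (fun p => Phi p u v)))))) p0).
(* The rest of the argument applies to any formula with these properties. *)
clearbody Phi.
apply fImp_intro; intros p hp [_ H]; assert (hcp := le_cond hp).
destruct (domain x) as [I hI].
assert (hIHS : forall z, z ∈ I -> HS S z) by (intros z [s hs]%hI; exact (proj1 (HS_pr hx hs))).
destruct (@pretame_decide _ _ PP _ (fun u s => u ∈ I /\ exists v, HS S v /\ Phi s u v) I p)
  as (q & e & hq & he & hdec); try tauto.
{ apply Cls2_intro; define. }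
{ intros u r s hs (hu & v & hv & h); split; [exact hu|exists v; split; eauto]. }
destruct (@collection _ _ e (fun w v => HS S v /\ exists u d, w = pr u d /\ Phi d u v))
  as (B & hB & hB'); [apply Cls2_intro; define|].
(* An automorphism may move [one PP] to another weakest condition, so the name is
   B' × b for a symmetric set b containing [one PP], and not B' × {1}. *)
destruct (singleton (one PP)) as [C hC].
destruct (@symmetric_cover _ _ _ _ hstrat B C) as
  (B' & b & a & ha & hBB' & hB'HS & hCb & hbP & hab & haB').
{ intros v hv; now destruct (hB' v hv) as (_ & _ & h & _). }
{ intros r ->%hC; apply (cf_one (ss_forcing hS)). }
destruct (@HS_comprehension B' b a (fun _ _ => True)) as (y & hy & hyE); auto.
{ apply Cls2_intro, definable_const. }
{ intros X z s z' s' hX hzz hss hz hs _; eauto. }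
exists q; split; [exact hq|]; intros q1 hq1; assert (hcq := le_cond hq1).
exists q1; split; [apply le_refl; tauto|exists y; split; [exact hy|]].
apply fAll_intro; intros u hu r hr; assert (hcr := le_cond hr).
exists r; split; [apply le_refl; tauto|].
apply fImp_intro; intros r1 hr1 hux; assert (hc1 := le_cond hr1).
exists r1; split; [apply le_refl; tauto|]; intros s hs; assert (hcs := le_cond hs).
apply (fInE hF) in hux; auto; try tauto.
destruct (hux s hs) as (s1 & hs1 & u1 & k & hu1 & hsk & e1).
destruct (fAll_elim H hu (q := s1)) as (s2 & hs2 & H2); [below|].
assert (hc2 := le_cond hs2).
assert (hu1I : u1 ∈ I) by (apply hI; now exists k).
assert (hu1HS := hIHS u1 hu1I).
assert (le PP s2 r1) by (below).
destruct (fImp_elim H2 (q := s2)) as (s3 & hs3 & H3);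
  [apply le_refl; tauto| |assert (hc3 := le_cond hs3)].
{ apply (fInE hF); auto; try tauto; intros s3 hs3; apply hux; below. }
destruct (H3 s3) as (s4 & hs4 & v & hv & H4); [apply le_refl; tauto|].
assert (hc4 := le_cond hs4).
assert (le PP s4 s1) by (below).
assert (e4 : fEq F s4 u u1) by (apply (fEq_mono hF) with (p := s1); auto).
assert (le PP s4 q) by (below).
destruct (hdec u1 s4 hu1I) as (d & s5 & hd & (_ & v' & hv' & hPd) & hs5 & hs5d); auto.
{ split; [auto|exists v; split; [auto|]]; apply hcongr with (u := u); auto; tauto. }
destruct (hB (pr u1 d) hd) as (v2 & hv2 & hv2HS & u2 & d2 & [<- <-]%pr_inj & hP2).
{ exists v'; split; [auto|now exists u1, d]. }
assert (hc5 := le_cond hs5).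
exists s5; split; [below|].
exists v2; split; [exact hv2HS|split].
- apply (fIn_pr hF) with (r := one PP); auto.
  + apply hyE; repeat split; auto; now apply hCb, hC.
  + apply (cf_weakest (ss_forcing hS)); tauto.
- apply hcongr with (u := u1); auto; try tauto.
  + apply (fEq_sym hF); auto; try tauto; apply (fEq_mono hF) with (p := s4); auto.
  + apply hmono with (p := d); auto.
Qed.

(** The formula for inclusion has the same truth value whether its bound variable
    ranges over all names or over symmetric names; with [forces_sub_elim], this
    relates the two versions of the powerset axiom. *)
Lemma forces_sub_intro (N : vset M -> Prop) p x z : (forall w, N w -> set_name PP w) ->
  set_name PP z -> set_name PP x -> fSub F p z x ->
  fAll PP N (fun w => fImp PP (fun p => fIn F p w z) (fun p => fIn F p w x)) p.
Proof.
intros hN hz hx h; apply fAll_intro; intros w hw q hq; assert (hc := le_cond hq).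
exists q; split; [apply le_refl; tauto|apply fImp_intro; intros r hr hwz].
assert (hcr := le_cond hr).
exists r; split; [apply le_refl; tauto|].
apply (fIn_sub hF) with (y := z); auto; try tauto.
apply (fSub_mono hF) with (p := p); auto; below.
Qed.

Lemma forces_sub_elim (N : vset M -> Prop) p x z : (forall w r, pr w r ∈ z -> N w) ->
  p ∈∈ cond PP -> set_name PP z -> set_name PP x ->
  fAll PP N (fun w => fImp PP (fun p => fIn F p w z) (fun p => fIn F p w x)) p ->
  fSub F p z x.
Proof.
intros hN hp hz hx h; apply (fSubE hF); auto; intros w r hw s hs hsr.
destruct (fAll_elim h (hN w r hw) hs) as (s1 & hs1 & h1).
assert (hc1 := le_cond hs1).
destruct (fImp_elim h1 (q := s1)) as (s2 & hs2 & h2).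
- apply le_refl; tauto.
- apply (fIn_pr hF) with (r := r); auto; below.
- exists s2; split; [below|exact h2].
Qed.

(** Let [yP] be a name, not necessarily symmetric, for the powerset of [x] in the
    extension by the whole forcing.  A symmetric name for a subset of [x] is
    forced to equal some [z'] inside [yP], so [pretame_decide] and collection
    over those [z'] give a set [B] of symmetric names such that every symmetric
    name for a subset of [x] is densely equal to one of them.  The conditions [d]
    used to choose the elements of [B] also force them to be subsets of [x]. *)
Lemma powerset_forced (A : vcls M) :
  forces PP (set_name PP) F powerset_fml (fun _ => one PP) (fun _ => A) (one PP) ->
  forces_powerset PP (HS S).
Proof.
intros HP; exists F; split; [exact atomic_forcing_HS|].
set (sub N x z := fAll PP N (fun w =>
  fImp PP (fun p => fIn F p w z) (fun p => fIn F p w x))).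
set (pow N x := fEx PP N (fun y => fAll PP N (fun z =>
  fIff PP (fun p => fIn F p z y) (sub N x z)))).
change (fAll PP (set_name PP) (pow (set_name PP)) (one PP)) in HP.
change (fAll PP (HS S) (pow (HS S)) (one PP)).
apply fAll_intro; intros x hx p hp.
destruct (fAll_elim HP (HS_set_name hx) hp) as (p1 & hp1 & H1).
assert (hc1 := le_cond hp1).
destruct (H1 p1) as (p2 & hp2 & yP & hyP & H2); [apply le_refl; tauto|].
assert (hc2 := le_cond hp2).
destruct (domain yP) as [I hI], (HS_fixed hx) as (a1 & ha1 & hfixx).
assert (hIn : forall z, z ∈ I -> set_name PP z)
  by (intros z [s hs]%hI; exact (proj1 (hereditarily_pr hyP hs))).
destruct (@pretame_decide _ _ PP _ (fun z' s => z' ∈ I /\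
  exists z, HS S z /\ fEq F s z z' /\ fSub F s z x) I p2) as (q & e & hq & he & hdec);
  try tauto.
{ apply Cls2_intro; define. }
{ intros z' r s hs (hz' & z & hz & h1 & h2); split; [exact hz'|exists z; repeat split; auto].
  - apply (fEq_mono hF) with (p := r); auto.
  - apply (fSub_mono hF) with (p := r); auto. }
destruct (@collection _ _ e (fun w v => HS S v /\ exists z' d, w = pr z' d /\
  fEq F d v z' /\ fSub F d v x)) as (B & hB & hB'); [apply Cls2_intro; define|].
destruct (range e) as [C hC].
destruct (@symmetric_cover _ _ _ _ hstrat B C) as
  (B' & b & a2 & ha2 & hBB' & hB'HS & hCb & hbP & hab & haB').
{ intros v hv; now destruct (hB' v hv) as (_ & _ & h & _). }
{ intros d [i hd]%hC; exact (he i d hd). }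
destruct (base_inter2 ha1 ha2) as (c & hc & hc').
destruct (@HS_comprehension B' b c (fun v s => fSub F s v x)) as (y & hy & hyE); auto.
{ apply Cls2_intro; define. }
{ intros X z s z' s' hX hzz hss hz hs h; destruct (hc' X hX) as [hX1 hX2].
  repeat split; eauto.
  apply (act_fSub hF (base_aut hc hX) hss (HS_set_name (hB'HS z hz)) (HS_set_name hx) hzz);
    auto. }
exists q; split; [below|]; intros q1 hq1; assert (hcq := le_cond hq1).
exists q1; split; [apply le_refl; tauto|exists y; split; [exact hy|]].
apply fAll_intro; intros z hz r hr; assert (hcr := le_cond hr).
exists r; split; [apply le_refl; tauto|].
split; apply fImp_intro; intros r1 hr1 h; assert (hcr1 := le_cond hr1).
- apply (fInE hF) in h; auto; try tauto.
  destruct (h r1) as (r2 & hr2 & v & s & (hv & hs & hsub)%hyE & hrs & e1);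
    [apply le_refl; tauto|assert (hcr2 := le_cond hr2)].
  assert (hvHS := hB'HS v hv).
  exists r2; split; [exact hr2|apply forces_sub_intro; auto].
  apply (fSubE hF); auto; try tauto; intros w t hw r3 hr3 hrt.
  assert (hcr3 := le_cond hr3).
  assert (set_name PP w) by (apply (HS_set_name), (HS_pr hz hw)).
  exists r3; split; [apply le_refl; tauto|].
  apply (fIn_sub hF) with (y := v); auto; try tauto.
  + apply (fSub_mono hF) with (p := s); auto; below.
  + apply (fIn_congr_r hF) with (y := z); auto; try tauto.
    * apply (fEq_mono hF) with (p := r2); auto.
    * apply (fIn_pr hF) with (r := t); auto.
- assert (hzx : fSub F r1 z x).
  { apply (forces_sub_elim (N := HS S)); auto; try tauto.
    intros w t hw; exact (proj1 (HS_pr hz hw)). }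
  assert (hr1q : le PP r1 q) by (below).
  destruct (fAll_elim H2 (HS_set_name hz) (q := r1)) as (s & hs & _ & h2); [below|].
  assert (hcs := le_cond hs).
  destruct (fImp_elim h2 (q := s)) as (s1 & hs1 & hzy); [apply le_refl; tauto| |].
  { apply forces_sub_intro; auto; apply (fSub_mono hF) with (p := r1); auto. }
  assert (hcs1 := le_cond hs1).
  apply (fInE hF) in hzy; auto; try tauto.
  destruct (hzy s1) as (s2 & hs2 & z' & t & hz' & hst & e2);
    [apply le_refl; tauto|assert (hcs2 := le_cond hs2)].
  assert (hz'I : z' ∈ I) by (apply hI; now exists t).
  assert (le PP s2 r1) by (below).
  destruct (hdec z' s2 hz'I) as (d & s3 & hd & (_ & v' & hv') & hs3 & hs3d); [below| |].
  { split; [auto|exists z; repeat split; auto].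
    apply (fSub_mono hF) with (p := r1); auto. }
  destruct (hB (pr z' d) hd) as (v & hv & hvHS & z2 & d2 & [<- <-]%pr_inj & e3 & hsub).
  { exists v'; split; [tauto|exists z', d; tauto]. }
  assert (hcs3 := le_cond hs3).
  exists s3; split; [below|].
  apply (fIn_congr_l hF) with (x := v); auto; try tauto.
  + apply (fEq_trans hF) with (y := z'); auto; try tauto.
    * apply (fEq_mono hF) with (p := d); auto.
    * apply (fEq_sym hF); auto; try tauto; apply (fEq_mono hF) with (p := s2); auto.
  + apply (fIn_pr hF) with (r := d); auto.
    apply hyE; repeat split; auto; apply hCb, hC; now exists z'.
Qed.

End Tame.

Unset Implicit Arguments.

Theorem theorem36 (M : structure) (hGB : GB M)
    (PP : forcing_triple M) (CG CF : vcls M)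
    (hPP : class_forcing PP) (htame : tame PP)
    (hS : class_symmetric_system (System PP CG CF))
    (hstrat : stratified (System PP CG CF)) :
  system_tame (System PP CG CF).
Proof.
destruct htame as (hpre & F & hF & HP).
split; [split|].
- exists F; exact (atomic_forcing_HS (S := System PP CG CF) hF).
- intros A hA; split.
  + exact (separation_forced hstrat hpre hF hA).
  + exact (collection_forced hstrat hpre hF hA).
- exact (powerset_forced hstrat hpre hF HP).
Qed.
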